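(* Every holomorphic Poisson structure on $W_1=\mathrm{Tot}(\mathcal O_{\mathbb P^1}(-1)\oplus\mathcal O_{\mathbb P^1}(-1))$ has the form $\sum_{i=1}^4p^ie_i$ with $p^1,p^2,p^3,p^4\in H^0(W_1,\mathcal O_{W_1})$ and $(p^1,p^2,p^3,p^4)\in\ker B$, where $e_1,\dots,e_4$ and the operator $B$ are those specified in the context.
   Context: $W_1$ is obtained by gluing $U=\mathbb C^3_{\{z,u_1,u_2\}}$ and $V=\mathbb C^3_{\{\xi,v_1,v_2\}}$ by $(\xi,v_1,v_2)=(z^{-1},zu_1,zu_2)$ where $z,\xi\ne0$. Write $\partial_0=\partial/\partial z$, $\partial_1=\partial/\partial u_1$, $\partial_2=\partial/\partial u_2$. A holomorphic Poisson structure is a global holomorphic bivector field $q\in H^0(W_1,\Lambda^2TW_1)$ whose Schouten–Nijenhuis self-bracket $[q,q]$ vanishes. The global bivector fields $e_i$ are those given on $U$ by $$e_1=\partial_2\wedge\partial_0,\quad e_2=\partial_0\wedge\partial_1,\quad e_3=u_1\,\partial_1\wedge\partial_2+z\,\partial_2\wedge\partial_0,\quad e_4=u_2\,\partial_1\wedge\partial_2+z\,\partial_0\wedge\partial_1 .$$ Global functions on $W_1$ are identified with their restrictions to $U$. The quasi-linear differential operator $B$ is $B(p^1,p^2,p^3,p^4)=\mathbf p^TQ\,\mathbf p$, where $\mathbf p=(p^1,p^2,p^3,p^4)^T$ and $$Q=\begin{bmatrix} 0&\partial_0&-u_1\partial_2&z\partial_0-u_2\partial_2\\ -\partial_0&0&-z\partial_0+u_1\partial_1&u_2\partial_1\\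 u_1\partial_2&z\partial_0-u_1\partial_1&0&z^2\partial_0-zu_1\partial_1-zu_2\partial_2\\ -z\partial_0+u_2\partial_2&-u_2\partial_1&-z^2\partial_0+zu_1\partial_1+zu_2\partial_2&0 \end{bmatrix};$$ that is, $B(\mathbf p)=\sum_{i,j}p^i\,(Q_{ij}p^j)$, the differential operators $Q_{ij}$ acting on $p^j$. Here $\ker B=B^{-1}(0)$ means the set of $\mathbf p\in H^0(W_1,\mathcal O_{W_1})^4$ with $B(\mathbf p)=0$. *)

(* Defs.v *)
From Stdlib Require Import Reals Lra.
From Coquelicot Require Import Coquelicot.

Open Scope C_scope.

Definition C3 : Type := (C * C * C)%type.

Inductive coord : Set := i0 | i1 | i2.

Definition sum_coord (f : coord -> C) : C := f i0 + f i1 + f i2.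

(** On the chart U the coordinates [i0, i1, i2] are z, u_1, u_2;
    on the chart V they are xi, v_1, v_2. *)
Definition proj (i : coord) (p : C3) : C :=
  match i with
  | i0 => fst (fst p)
  | i1 => snd (fst p)
  | i2 => snd p
  end.

Definition set_coord (i : coord) (t : C) (p : C3) : C3 :=
  match i with
  | i0 => (t, proj i1 p, proj i2 p)
  | i1 => (proj i0 p, t, proj i2 p)
  | i2 => (proj i0 p, proj i1 p, t)
  end.

(** Complex Frechet differentiability at every point of C^3. *)
Definition holomorphic (f : C3 -> C) : Prop :=
  forall p : C3,
    ex_filterdiff (K := C_AbsRing)
      (U := prod_NormedModule C_AbsRing
              (prod_NormedModule C_AbsRing C_NormedModule C_NormedModule)
              C_NormedModule)
      (V := C_NormedModule) f (locally p).

(** [C_derive] is a total function; it is the complex derivative wherever the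
    latter exists, by [is_C_derive_unique].  It is only applied to
    holomorphic functions and to [glue] away from z = 0. *)
Definition partial (i : coord) (f : C3 -> C) (p : C3) : C :=
  C_derive (fun t => f (set_coord i t p)) (proj i p).

Definition vector_field : Type := coord -> C3 -> C.

(** [q i j] is the (i,j) component of the skew-symmetric contravariant
    2-tensor: q = sum_{i<j} q^{ij} d_i /\ d_j = 1/2 sum_{i,j} q^{ij} d_i /\ d_j. *)
Definition bivector_field : Type := coord -> coord -> C3 -> C.

Definition trivector_field : Type := coord -> coord -> coord -> C3 -> C.

Definition d_ (i : coord) : vector_field :=
  fun k _ =>
    match i, k with
    | i0, i0 | i1, i1 | i2, i2 => 1
    | _, _ => 0
    end.

Definition wedge (v w : vector_field) : bivector_field :=
  fun i j p => v i p * w j p - v j p * w i p.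

Definition bv_add (q r : bivector_field) : bivector_field :=
  fun i j p => q i j p + r i j p.

Definition bv_scal (f : C3 -> C) (q : bivector_field) : bivector_field :=
  fun i j p => f p * q i j p.

Definition bv_opp (q : bivector_field) : bivector_field :=
  fun i j p => - q i j p.

Definition holomorphic_bivector (q : bivector_field) : Prop :=
  (forall i j p, q j i p = - q i j p) /\ (forall i j, holomorphic (q i j)).

(** Coordinate expression of the Schouten-Nijenhuis bracket of bivector fields
    extending [X1 /\ X2, Y1 /\ Y2]
      = sum_{a,b} (-1)^(a+b) [X_a, Y_b] /\ X_{3-a} /\ Y_{3-b},
    with components normalized by T = sum_{i<j<k} T^{ijk} d_i /\ d_j /\ d_k. *)
Definition schouten (q r : bivector_field) : trivector_field :=
  fun i j k p =>
    let c i j k :=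
      sum_coord (fun l => q i l p * partial l (r j k) p
                        + r i l p * partial l (q j k) p) in
    c i j k + c j k i + c k i j.

(** The gluing map (z, u_1, u_2) |-> (z^-1, z u_1, z u_2), on z <> 0. *)
Definition glue (p : C3) : C3 :=
  (/ proj i0 p, proj i0 p * proj i1 p, proj i0 p * proj i2 p).

Definition jac (k i : coord) (p : C3) : C :=
  partial i (fun y => proj k (glue y)) p.

(** A section of a sheaf on the glued space W_1 is a pair of sections on U and
    on V that agree on the overlap. *)
Record global_function : Type := {
  fun_U : C3 -> C;
  fun_V : C3 -> C;
  fun_U_holo : holomorphic fun_U;
  fun_V_holo : holomorphic fun_V;
  fun_glue : forall p, proj i0 p <> 0 -> fun_V (glue p) = fun_U p
}.

(** Bivectors on the overlap are identified by pushing forward along [glue]. *)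
Definition bivector_glue (qU qV : bivector_field) : Prop :=
  forall p, proj i0 p <> 0 -> forall k l,
    qV k l (glue p) =
    sum_coord (fun i => sum_coord (fun j => jac k i p * jac l j p * qU i j p)).

Record global_bivector : Type := {
  biv_U : bivector_field;
  biv_V : bivector_field;
  biv_U_holo : holomorphic_bivector biv_U;
  biv_V_holo : holomorphic_bivector biv_V;
  biv_glue : bivector_glue biv_U biv_V
}.

Definition poisson (q : global_bivector) : Prop :=
  (forall i j k p, schouten (biv_U q) (biv_U q) i j k p = 0) /\
  (forall i j k p, schouten (biv_V q) (biv_V q) i j k p = 0).

Inductive gen : Set := g1 | g2 | g3 | g4.

Definition sum_gen (f : gen -> C) : C := f g1 + f g2 + f g3 + f g4.

Definition e_U (g : gen) : bivector_field :=
  let z := proj i0 in let u1 := proj i1 in let u2 := proj i2 in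
  match g with
  | g1 => wedge (d_ i2) (d_ i0)
  | g2 => wedge (d_ i0) (d_ i1)
  | g3 => bv_add (bv_scal u1 (wedge (d_ i1) (d_ i2)))
                 (bv_scal z (wedge (d_ i2) (d_ i0)))
  | g4 => bv_add (bv_scal u2 (wedge (d_ i1) (d_ i2)))
                 (bv_scal z (wedge (d_ i0) (d_ i1)))
  end.

(** The (unique) continuations of the [e_U g] to V, from
    d/dz = - xi^2 d/dxi + xi v_1 d/dv_1 + xi v_2 d/dv_2, d/du_i = xi^-1 d/dv_i. *)
Definition e_V (g : gen) : bivector_field :=
  let xi := proj i0 in let v1 := proj i1 in let v2 := proj i2 in
  match g with
  | g1 => bv_opp (bv_add (bv_scal xi (wedge (d_ i2) (d_ i0)))
                         (bv_scal v1 (wedge (d_ i1) (d_ i2))))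
  | g2 => bv_opp (bv_add (bv_scal xi (wedge (d_ i0) (d_ i1)))
                         (bv_scal v2 (wedge (d_ i1) (d_ i2))))
  | g3 => bv_opp (wedge (d_ i2) (d_ i0))
  | g4 => bv_opp (wedge (d_ i0) (d_ i1))
  end.

Lemma holomorphic_ext (f g : C3 -> C) :
  (forall p, f p = g p) -> holomorphic f -> holomorphic g.
Proof.
  intros H Hf p. destruct (Hf p) as [l Hl]. exists l.
  now apply filterdiff_ext with f.
Qed.

Lemma holomorphic_const (c : C) : holomorphic (fun _ => c).
Proof. intros p. eexists. apply filterdiff_const. Qed.

Lemma holomorphic_proj (i : coord) : holomorphic (proj i).
Proof.
  intros p. exists (proj i). apply filterdiff_linear. destruct i.
  - apply (is_linear_comp fst fst); apply is_linear_fst.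
  - apply (is_linear_comp fst snd); [apply is_linear_fst | apply is_linear_snd].
  - apply is_linear_snd.
Qed.

Lemma holomorphic_opp (f : C3 -> C) :
  holomorphic f -> holomorphic (fun p => - f p).
Proof.
  intros Hf p. destruct (Hf p) as [l Hl].
  exists (fun t => opp (l t)).
  exact (filterdiff_opp_fct (V := C_NormedModule) f l Hl).
Qed.

Ltac holo_affine :=
  first
    [ apply holomorphic_ext with (fun _ => 0);
      [intros p; ring | apply holomorphic_const]
    | apply holomorphic_ext with (fun _ => 1);
      [intros p; ring | apply holomorphic_const]
    | apply holomorphic_ext with (fun _ => - 1);
      [intros p; ring | apply holomorphic_const]
    | match goal with
      | |- context [proj ?i] =>
        first
          [ apply holomorphic_ext with (proj i);
            [intros p; ring | apply holomorphic_proj]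
          | apply holomorphic_ext with (fun p => - proj i p);
            [intros p; ring | apply holomorphic_opp, holomorphic_proj] ]
      end ].

Ltac holo_biv :=
  unfold bv_opp, bv_add, bv_scal, wedge, d_; split;
  [ intros [] [] p; ring | intros [] []; holo_affine ].

Lemma e_U_holo (g : gen) : holomorphic_bivector (e_U g).
Proof. destruct g; unfold e_U; holo_biv. Qed.

Lemma e_V_holo (g : gen) : holomorphic_bivector (e_V g).
Proof. destruct g; unfold e_V; holo_biv. Qed.

Lemma is_derive_C_affine (a b z : C) :
  is_derive (K := C_AbsRing) (V := C_NormedModule) (fun t => a * t + b) z a.
Proof.
  split; [apply is_linear_scal_l|].
  intros y Hy eps.
  apply filter_forall. intros t.
  change (Cmod (a * t + b - (a * y + b) - (t - y) * a) <= eps * Cmod (t - y))%R.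
  replace (a * t + b - (a * y + b) - (t - y) * a) with (RtoC 0) by ring.
  rewrite Cmod_0.
  apply Rmult_le_pos; [left; apply cond_pos | apply Cmod_ge_0].
Qed.

Lemma is_derive_Cinv (z : C) : z <> 0 ->
  is_derive (K := C_AbsRing) (V := C_NormedModule) (fun t => / t) z (- / (z * z)).
Proof.
  intros Hz. split; [apply is_linear_scal_l|].
  intros y Hy eps.
  apply (is_filter_lim_locally_unique
           (V := AbsRing_NormedModule C_AbsRing)) in Hy.
  change C in y. change (z = y) in Hy. rewrite <- Hy. clear y Hy.
  assert (Hz0 : (0 < Cmod z)%R) by now apply Cmod_gt_0.
  set (m := Cmod z) in *.
  assert (Hd : (0 < Rmin (m / 2) (eps * (m * m * m) / 2))%R).
  { apply Rmin_pos; [lra|]. pose proof (cond_pos eps).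
    assert (0 < eps * (m * m * m))%R by (repeat apply Rmult_lt_0_compat; lra).
    lra. }
  exists (mkposreal _ Hd). intros t Ht.
  change C in t.
  change (Cmod (t - z) < Rmin (m / 2) (eps * (m * m * m) / 2))%R in Ht.
  change (Cmod ((/ t - / z) - (t - z) * (- / (z * z))) <= eps * Cmod (t - z))%R.
  assert (H1 := Rmin_l (m / 2) (eps * (m * m * m) / 2)).
  assert (H2 := Rmin_r (m / 2) (eps * (m * m * m) / 2)).
  assert (Htm : (m / 2 < Cmod t)%R).
  { assert (H := Cmod_triangle t (z - t)).
    replace (t + (z - t)) with z in H by ring.
    replace (z - t) with (- (t - z)) in H by ring. rewrite Cmod_opp in H.
    fold m in H. lra. }
  assert (Ht0 : t <> 0) by (apply Cmod_gt_0; lra).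
  replace ((/ t - / z) - (t - z) * (- / (z * z)))
    with ((t - z) * (t - z) * / (z * z * t))
    by (field; split; assumption).
  assert (Hzzt : z * z * t <> 0) by (repeat apply Cmult_neq_0; assumption).
  rewrite !Cmod_mult, Cmod_inv, !Cmod_mult by exact Hzzt. fold m.
  set (d := Cmod (t - z)) in *.
  assert (Hd0 : (0 <= d)%R) by apply Cmod_ge_0.
  rewrite Rmult_assoc, (Rmult_comm eps d).
  apply Rmult_le_compat_l; [exact Hd0|].
  assert (Hmm : (0 < m * m)%R) by (apply Rmult_lt_0_compat; lra).
  assert (HD : (0 < m * m * Cmod t)%R) by (apply Rmult_lt_0_compat; lra).
  apply (Rmult_le_reg_r _ _ _ HD).
  rewrite Rmult_assoc, Rinv_l, Rmult_1_r by lra.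
  apply Rle_trans with (eps * (m * m * m) / 2)%R; [lra|].
  replace (eps * (m * m * m) / 2)%R with (eps * (m * m * (m / 2)))%R by field.
  apply Rmult_le_compat_l; [left; apply cond_pos|].
  apply Rmult_le_compat_l; lra.
Qed.

Lemma C_derive_eq (f g : C -> C) (z l : C) :
  is_derive (K := C_AbsRing) (V := C_NormedModule) g z l ->
  (forall t, g t = f t) -> C_derive f z = l.
Proof.
  intros H Hfg. apply is_C_derive_unique.
  exact (is_derive_ext g f z l Hfg H).
Qed.

Lemma jac_glue (k i : coord) (p : C3) : proj i0 p <> 0 ->
  jac k i p =
  match k, i with
  | i0, i0 => - / (proj i0 p * proj i0 p)
  | i1, i0 => proj i1 p
  | i2, i0 => proj i2 p
  | i1, i1 | i2, i2 => proj i0 p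
  | _, _ => 0
  end.
Proof.
  intros Hp. unfold jac, partial.
  destruct k, i; cbn [proj glue set_coord fst snd];
    match goal with
    | |- _ = - _ =>
      eapply C_derive_eq; [apply (is_derive_Cinv _ Hp) | reflexivity]
    | |- C_derive ?f _ = ?a =>
      apply (C_derive_eq _ _ _ _
               (is_derive_C_affine a (f 0 - a * 0) _));
      intros t; cbn; ring
    end.
Qed.

Lemma e_glue (g : gen) : bivector_glue (e_U g) (e_V g).
Proof.
  intros p Hp k l. unfold sum_coord. rewrite !jac_glue by exact Hp.
  destruct g, k, l; unfold e_U, e_V, bv_opp, bv_add, bv_scal, wedge, d_, glue;
    cbn [proj fst snd]; field; exact Hp.
Qed.

Definition e_ (g : gen) : global_bivector := {|
  biv_U := e_U g;
  biv_V := e_V g;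
  biv_U_holo := e_U_holo g;
  biv_V_holo := e_V_holo g;
  biv_glue := e_glue g
|}.

Definition is_combination (q : global_bivector) (p : gen -> global_function) :=
  (forall i j x,
     biv_U q i j x = sum_gen (fun g => fun_U (p g) x * biv_U (e_ g) i j x)) /\
  (forall i j x,
     biv_V q i j x = sum_gen (fun g => fun_V (p g) x * biv_V (e_ g) i j x)).

Definition diff_op : Type := (C3 -> C) -> C3 -> C.

Definition Q (i j : gen) : diff_op := fun f x =>
  let z := proj i0 x in let u1 := proj i1 x in let u2 := proj i2 x in
  let d0 := partial i0 f x in
  let d1 := partial i1 f x in
  let d2 := partial i2 f x in
  match i, j with
  | g1, g1 => 0
  | g1, g2 => d0
  | g1, g3 => - u1 * d2
  | g1, g4 => z * d0 - u2 * d2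
  | g2, g1 => - d0
  | g2, g2 => 0
  | g2, g3 => - z * d0 + u1 * d1
  | g2, g4 => u2 * d1
  | g3, g1 => u1 * d2
  | g3, g2 => z * d0 - u1 * d1
  | g3, g3 => 0
  | g3, g4 => z * z * d0 - z * u1 * d1 - z * u2 * d2
  | g4, g1 => - z * d0 + u2 * d2
  | g4, g2 => - u2 * d1
  | g4, g3 => - (z * z) * d0 + z * u1 * d1 + z * u2 * d2
  | g4, g4 => 0
  end.

Definition B (p : gen -> C3 -> C) (x : C3) : C :=
  sum_gen (fun i => sum_gen (fun j => p i x * Q i j (p j) x)).

(** Global functions are identified with their restrictions to U. *)
Definition ker_B (p : gen -> global_function) : Prop :=
  forall x, B (fun g => fun_U (p g)) x = 0.

(* Main.v *)
Require Import Defs.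
From Stdlib Require Import Reals Lra Lia ClassicalEpsilon.
From Coquelicot Require Import Coquelicot.
Open Scope C_scope.

(** Write [q] as [a d1/\d2 + b d2/\d0 + c d0/\d1] on U and with components
    [A, B, C] on V.  For [(xi, v1, v2)] the image of [(z, u1, u2)], the change
    of chart reads
      [A = z^2 a - z u1 b - z u2 c],  [B = - b / z],  [C = - c / z],
    and [q = sum_i p^i e_i] on U means
      [a = u1 p3 + u2 p4],  [b = p1 + z p3],  [c = p2 + z p4].
    In Laurent terms, a monomial [z^n u1^k u2^l] is global when [n <= k + l],
    while [b] and [c] may reach [n = k + l + 1].  Their top parts force those
    of [p3] and [p4] to be [- B (0, z u1, z u2)] and [- C (0, z u1, z u2)].
    Once these are subtracted, the rest [a'] of [a] has [n <= k + l - 2]: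
    precisely, [z^2 a'] extends to V as
      [A' = A - v1 (B - B(0,v)) / xi - v2 (C - C(0,v)) / xi].
    It remains to write [a' = u1 k1 + u2 k2].  This is possible because [a]
    vanishes on the zero section, where [z^2 a = A(1/z, 0, 0)] makes it an
    entire function of [z] that tends to 0 at infinity.  Dividing by [u1], then
    by [u2] what is left on [u1 = 0], costs one power of [z] out of the two
    available ([hadamard_quotient_glue]); the other one lets [p1 = b - z p3] and
    [p2 = c - z p4] extend to V.  This is [generators_span].  Substituting the
    three formulas into the Schouten bracket gives [2 B(p)] ([schouten_B]),
    so the bracket vanishes only if [p] is in the kernel of [B].

    The analytic input is that the difference quotients above are holomorphic
    ([hadamard]) and that an entire function tending to 0 at infinity vanishes.
    Holomorphy being mere pointwise differentiability, this starts from
    Goursat's theorem on rectangles ([goursat]).  Applied to the function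
    [g(w + exp zeta) exp(- zeta)], which has period [2 i pi], it shows that its
    integral over a vertical period does not depend on the abscissa; letting
    the abscissa tend to minus infinity gives
      [2 pi g'(w) = integral over [0, 2 pi] of g(w + e^(i t)) e^(- i t)]
    ([circle_derive]).  The right-hand side depends continuously on every
    parameter on which [g] does.  So the partial derivatives of a continuous
    separately holomorphic function are continuous, such a function is Frechet
    holomorphic ([osgood]), and holomorphy passes to integrals over a
    parameter ([holomorphic_cint]).  The quotient [(f(x) - f(x | x_i = 0)) / x_i]
    is one of them: the integral over [0 <= t <= 1] of
    [d_i f (x | x_i := t x_i)]. *)

(** * Complex derivatives, continuity and integrals of complex-valued functions *)

Definition is_Cderive (f : C -> C) (z l : C) : Prop :=
  is_derive (K := C_AbsRing) (V := C_NormedModule) f z l.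

Lemma Rdiv_plus_1_le (x : R) : (0 <= x)%R -> (x / (x + 1) <= 1)%R.
Proof.
  intros Hx. apply (Rmult_le_reg_r (x + 1)); [lra|].
  unfold Rdiv. rewrite Rmult_assoc, Rinv_l by lra. lra.
Qed.

Lemma Cmod_le_eps_0 (x : C) (K : R) : (0 <= K)%R ->
  (forall eps : posreal, (Cmod x <= K * eps)%R) -> x = 0.
Proof.
  intros HK H. apply Cmod_eq_0, Rle_antisym; [|apply Cmod_ge_0].
  apply Rnot_lt_le. intros Hpos.
  assert (He : (0 < Cmod x / (K + 1))%R) by (apply Rdiv_lt_0_compat; lra).
  specialize (H (mkposreal _ He)). simpl in H.
  replace (K * (Cmod x / (K + 1)))%R with (Cmod x - Cmod x / (K + 1))%R in H by (field; lra).
  lra.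
Qed.

Lemma is_Cderive_eps (f : C -> C) (z l : C) :
  is_Cderive f z l <->
  forall eps : posreal, exists d : posreal, forall h : C,
    (Cmod h < d)%R -> (Cmod (f (z + h)%C - f z - h * l) <= eps * Cmod h)%R.
Proof.
  split.
  - intros [_ H] eps.
    destruct (H z (fun P HP => HP) eps) as [d Hd].
    exists d. intros h Hh.
    assert (Hb : @ball (AbsRing_UniformSpace C_AbsRing) z d (z + h)%C).
    { change (Cmod ((z + h) - z) < d)%R. now replace (z + h - z) with h by ring. }
    specialize (Hd (z + h) Hb).
    change (Cmod (f (z + h)%C - f z - (z + h - z) * l) <= eps * Cmod (z + h - z))%R in Hd.
    now replace (z + h - z) with h in Hd by ring.
  - intros H. split; [apply is_linear_scal_l|].
    intros y Hy eps.
    apply (is_filter_lim_locally_unique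
           (V := AbsRing_NormedModule C_AbsRing)) in Hy.
    change C in y. change (z = y) in Hy. subst y.
    destruct (H eps) as [d Hd]. exists d. intros t Ht. change C in t.
    change (Cmod (t - z) < d)%R in Ht.
    change (Cmod (f t - f z - (t - z) * l) <= eps * Cmod (t - z))%R.
    specialize (Hd (t - z) Ht). now replace (z + (t - z)) with t in Hd by ring.
Qed.

(** Continuity is defined with the balls of the product [R * R]; this is the
    form with the modulus. *)
Lemma continuous_C_eps {X : UniformSpace} (f : X -> C) (x : X) :
  continuous (U := C_UniformSpace) f x <->
  forall eps : posreal, locally x (fun y => (Cmod (f y - f x) < eps)%R).
Proof.
  split.
  - intros H eps.
    assert (He : (0 < eps / 2)%R) by (pose proof (cond_pos eps); lra).
    pose (e := mkposreal _ He).
    assert (Hb : locally (f x : C_UniformSpace) (fun w : C => (Cmod (w - f x) < eps)%R)).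
    { exists e. intros w Hw.
      apply (C_NormedModule_mixin_compat2 (f x) w e) in Hw.
      eapply Rlt_le_trans; [exact Hw|]. simpl.
      assert (sqrt 2 <= 2)%R.
      { rewrite <- (sqrt_square 2) at 2 by lra. apply sqrt_le_1_alt. lra. }
      pose proof (cond_pos eps). nra. }
    exact (H _ Hb).
  - intros H P [e He].
    destruct (H e) as [d Hd]. exists d. intros y Hy. apply He.
    apply (C_NormedModule_mixin_compat1 (f x) (f y) e). now apply Hd.
Qed.

(** [RInt] in the real Banach space C, where the fundamental theorem of calculus
    and the mean bound are available; linearity over C is [cint_scal]. *)
Definition cint (a b : R) (f : R -> C) : C :=
  RInt (V := C_R_CompleteNormedModule) f a b.

Definition contC {X : UniformSpace} (f : X -> C) : Prop :=
  forall x, continuous (U := C_UniformSpace) f x.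

Notation contR := (contC (X := R_UniformSpace)).

Lemma cint_correct a b (f : R -> C) : contR f ->
  is_RInt (V := C_R_NormedModule) f a b (cint a b f).
Proof.
  intros H. apply (RInt_correct (V := C_R_CompleteNormedModule)).
  apply (ex_RInt_continuous (V := C_R_CompleteNormedModule)). intros z _. apply H.
Qed.

Lemma cint_unique a b f l :
  is_RInt (V := C_R_NormedModule) f a b l -> cint a b f = l.
Proof. intros H. exact (is_RInt_unique (V := C_R_CompleteNormedModule) f a b l H). Qed.

Lemma cint_ext a b f g : (forall t, f t = g t) -> cint a b f = cint a b g.
Proof. intros H. apply (RInt_ext (V := C_R_CompleteNormedModule)). intros; apply H. Qed.

Lemma cint_plus a b (f g : R -> C) : contR f -> contR g ->
  cint a b (fun t => f t + g t) = cint a b f + cint a b g.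
Proof.
  intros Hf Hg. apply cint_unique.
  exact (is_RInt_plus (V := C_R_NormedModule) f g a b _ _ (cint_correct a b f Hf)
    (cint_correct a b g Hg)).
Qed.

Lemma cint_scal a b c (f : R -> C) : contR f ->
  cint a b (fun t => c * f t) = c * cint a b f.
Proof.
  intros Hf. apply cint_unique.
  pose proof (cint_correct a b f Hf) as H.
  pose proof (is_RInt_fct_extend_fst (U := R_NormedModule) (V := R_NormedModule) _ _ _ _ H) as H1.
  pose proof (is_RInt_fct_extend_snd (U := R_NormedModule) (V := R_NormedModule) _ _ _ _ H) as H2.
  apply (is_RInt_fct_extend_pair (U := R_NormedModule) (V := R_NormedModule)).
  - exact (is_RInt_minus (V := R_NormedModule) _ _ _ _ _ _
      (is_RInt_scal (V := R_NormedModule) _ _ _ (fst c) _ H1)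
      (is_RInt_scal (V := R_NormedModule) _ _ _ (snd c) _ H2)).
  - exact (is_RInt_plus (V := R_NormedModule) _ _ _ _ _ _
      (is_RInt_scal (V := R_NormedModule) _ _ _ (fst c) _ H2)
      (is_RInt_scal (V := R_NormedModule) _ _ _ (snd c) _ H1)).
Qed.

Lemma cint_const a b (c : C) : cint a b (fun _ => c) = (b - a)%R * c.
Proof.
  apply cint_unique. rewrite <- scal_R_Cmult.
  exact (is_RInt_const (V := C_R_NormedModule) a b c).
Qed.

Lemma cint_Chasles a b c (f : R -> C) : contR f ->
  cint a b f + cint b c f = cint a c f.
Proof.
  intros Hf. symmetry. apply cint_unique.
  exact (is_RInt_Chasles (V := C_R_NormedModule) f a b c _ _ (cint_correct a b f Hf)
    (cint_correct b c f Hf)).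
Qed.

Lemma cint_bound a b (f : R -> C) M : contR f -> (a <= b)%R ->
  (forall t, (a <= t <= b)%R -> (Cmod (f t) <= M)%R) ->
  (Cmod (cint a b f) <= (b - a) * M)%R.
Proof.
  intros Hf Hab HM. rewrite Cmod_norm.
  apply (norm_RInt_le_const (V := C_R_NormedModule) f a b _ M Hab).
  - intros t Ht. rewrite <- Cmod_norm. now apply HM.
  - now apply cint_correct.
Qed.

Lemma is_derive_RC (f : R -> C) (x : R) (l : C) :
  (forall eps : posreal, exists d : posreal, forall u : R, (Rabs u < d)%R ->
    (Cmod (f (x + u)%R - f x - u * l) <= eps * Rabs u)%R) ->
  is_derive (K := R_AbsRing) (V := C_R_NormedModule) f x l.
Proof.
  intros H. split; [apply is_linear_scal_l|].
  intros y Hy eps.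
  apply (is_filter_lim_locally_unique (V := R_NormedModule)) in Hy.
  change R in y. change (x = y) in Hy. subst y.
  destruct (H eps) as [d Hd]. exists d. intros t Ht. change R in t.
  change (Rabs (t - x) < d)%R in Ht.
  specialize (Hd (t - x)%R Ht). replace (x + (t - x))%R with t in Hd by ring.
  rewrite Cmod_norm in Hd. rewrite <- scal_R_Cmult in Hd.  exact Hd.
Qed.

Lemma cint_derive (f df : R -> C) a b :
  (forall x, is_derive (K := R_AbsRing) (V := C_R_NormedModule) f x (df x)) ->
  contR df -> cint a b df = f b - f a.
Proof.
  intros Hf Hdf. apply cint_unique.
  apply (is_RInt_derive (V := C_R_CompleteNormedModule) f df a b).
  - intros x _. apply Hf.
  - intros x _. apply Hdf.
Qed.
Definition ex_Cderive (f : C -> C) (z : C) : Prop := exists l, is_Cderive f z l.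

Definition entire (f : C -> C) : Prop := forall z, ex_Cderive f z.

Lemma Cderive_correct f z : ex_Cderive f z -> is_Cderive f z (C_derive f z).
Proof. intros [l Hl]. now rewrite (is_C_derive_unique f z l Hl). Qed.

Lemma is_Cderive_ext f g z l :
  (forall t, f t = g t) -> is_Cderive f z l -> is_Cderive g z l.
Proof. intros H. exact (is_derive_ext (K := C_AbsRing) (V := C_NormedModule) f g z l H). Qed.

Lemma is_Cderive_const (c z : C) : is_Cderive (fun _ => c) z 0.
Proof. exact (is_derive_const (K := C_AbsRing) (V := C_NormedModule) c z). Qed.

Lemma is_Cderive_id (z : C) : is_Cderive (fun t => t) z 1.
Proof.
  apply is_Cderive_ext with (fun t => 1 * t + 0); [intros t; ring|].
  apply is_derive_C_affine.
Qed.

Lemma is_Cderive_plus f g z lf lg : is_Cderive f z lf -> is_Cderive g z lg ->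
  is_Cderive (fun t => f t + g t) z (lf + lg).
Proof. exact (is_derive_plus (K := C_AbsRing) (V := C_NormedModule) f g z lf lg). Qed.

(** Seen as a module over itself, C has a uniform structure built from the
    modulus instead of the product balls, so that the two types of linear maps
    are distinct although they have the same fields. *)
Lemma filterdiff_AbsRing_C {U : NormedModule C_AbsRing} (f l : U -> C) F :
  filterdiff (V := AbsRing_NormedModule C_AbsRing) f F l <->
  filterdiff (V := C_NormedModule) f F l.
Proof.
  split; intros [[H1 H2 H3] H]; (split; [split; [exact H1 | exact H2 | exact H3] | exact H]).
Qed.

Lemma is_Cderive_mult f g z lf lg : is_Cderive f z lf -> is_Cderive g z lg ->
  is_Cderive (fun t => f t * g t) z (lf * g z + f z * lg).
Proof.
  intros Hf Hg.
  apply filterdiff_AbsRing_C in Hf, Hg. apply filterdiff_AbsRing_C.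
  exact (is_derive_mult (K := C_AbsRing) f g z lf lg Hf Hg Cmult_comm).
Qed.

Lemma is_Cderive_comp f g z lf lg : is_Cderive f (g z) lf -> is_Cderive g z lg ->
  is_Cderive (fun t => f (g t)) z (lg * lf).
Proof.
  intros Hf Hg.
  apply filterdiff_AbsRing_C in Hg.
  exact (is_derive_comp (K := C_AbsRing) (V := C_NormedModule) f g z lf lg Hf Hg).
Qed.

Lemma entire_const c : entire (fun _ => c).
Proof. intros z. eexists. apply is_Cderive_const. Qed.

Lemma entire_id : entire (fun z => z).
Proof. intros z. eexists. apply is_Cderive_id. Qed.

Lemma entire_plus f g : entire f -> entire g -> entire (fun z => f z + g z).
Proof.
  intros Hf Hg z. destruct (Hf z), (Hg z). eexists. apply is_Cderive_plus; eassumption.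
Qed.

Lemma entire_mult f g : entire f -> entire g -> entire (fun z => f z * g z).
Proof.
  intros Hf Hg z. destruct (Hf z), (Hg z). eexists. apply is_Cderive_mult; eassumption.
Qed.

Lemma entire_opp f : entire f -> entire (fun z => - f z).
Proof.
  intros Hf z. destruct (entire_mult _ f (entire_const (- (1))) Hf z) as [l Hl].
  exists l. revert Hl. apply is_Cderive_ext. intros t. ring.
Qed.

Lemma entire_comp f g : entire f -> entire g -> entire (fun z => f (g z)).
Proof.
  intros Hf Hg z. destruct (Hf (g z)), (Hg z). eexists. apply is_Cderive_comp; eassumption.
Qed.

Lemma continuous_pair {X Y Z : UniformSpace} (f : X -> Y) (g : X -> Z) x :
  continuous f x -> continuous g x ->
  continuous (U := prod_UniformSpace Y Z) (fun t => (f t, g t)) x.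
Proof.
  intros Hf Hg P [e He].
  assert (H1 : locally (f x) (ball (f x) e)) by apply locally_ball.
  assert (H2 : locally (g x) (ball (g x) e)) by apply locally_ball.
  destruct (Hf _ H1) as [d1 A1], (Hg _ H2) as [d2 A2].
  exists (mkposreal _ (Rmin_stable_in_posreal d1 d2)). intros t Ht. simpl in Ht.
  apply He. split; [apply A1 | apply A2]; eapply ball_le; try exact Ht.
  - apply Rmin_l.
  - apply Rmin_r.
Qed.

Lemma entire_contC f : entire f -> contC (X := C_UniformSpace) f.
Proof.
  intros H z. apply continuous_C_eps. intros eps.
  destruct (H z) as [l Hl]. rewrite is_Cderive_eps in Hl.
  destruct (Hl (mkposreal 1 Rlt_0_1)) as [d Hd]. simpl in Hd.
  pose proof (Cmod_ge_0 l) as Hl0.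
  assert (Hm : (0 < Rmin d (eps / (Cmod l + 1)))%R).
  { apply Rmin_pos; [apply cond_pos|]. apply Rdiv_lt_0_compat; [apply cond_pos|lra]. }
  assert (Hloc : locally (z : C_UniformSpace) (fun y : C => (Cmod (y - z)
    < Rmin d (eps / (Cmod l + 1)))%R)).
  { exact (proj1 (continuous_C_eps (X := C_UniformSpace) (fun y => y) z)
    (continuous_id (z : C_UniformSpace)) (mkposreal _ Hm)). }
  revert Hloc. apply filter_imp. intros y Hy. change C in y.
  assert (H1 := Rmin_l d (eps / (Cmod l + 1))).
  assert (H2 := Rmin_r d (eps / (Cmod l + 1))).
  assert (Hyd : (Cmod (y - z) < d)%R) by lra.
  specialize (Hd _ Hyd). replace (z + (y - z)) with y in Hd by ring.
  replace (f y - f z) with ((f y - f z - (y - z) * l) + (y - z) * l) by ring.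
  eapply Rle_lt_trans; [apply Cmod_triangle|]. rewrite Cmod_mult.
  apply Rle_lt_trans with (Cmod (y - z) * (Cmod l + 1))%R; [lra|].
  apply Rlt_le_trans with (eps / (Cmod l + 1) * (Cmod l + 1))%R.
  - apply Rmult_lt_compat_r; lra.
  - right. field. lra.
Qed.

Lemma contC_comp {X : UniformSpace} (f : C -> C) (g : X -> C) :
  contC (X := C_UniformSpace) f -> contC g -> contC (fun x => f (g x)).
Proof.
  intros Hf Hg x.
  apply (continuous_comp (V := C_UniformSpace) (W := C_UniformSpace) g f x); [apply Hg|apply Hf].
Qed.

Lemma contC_pair {X : UniformSpace} (f g : X -> R) :
  (forall x, continuous f x) -> (forall x, continuous g x) ->
  contC (fun x => (f x, g x)).
Proof. intros Hf Hg x. apply (continuous_pair (Y := R_UniformSpace) (Z := R_UniformSpace));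
  auto. Qed.

Lemma contC_const {X : UniformSpace} (c : C) : contC (fun _ : X => c).
Proof. intros x. apply (continuous_const (U := X) (V := C_UniformSpace)). Qed.

Lemma contC_plus {X : UniformSpace} (f g : X -> C) :
  contC f -> contC g -> contC (fun x => f x + g x).
Proof.
  intros Hf Hg x. exact (continuous_plus (V := C_NormedModule) f g x (Hf x) (Hg x)).
Qed.

Lemma contC_mult {X : UniformSpace} (f g : X -> C) :
  contC f -> contC g -> contC (fun x => f x * g x).
Proof.
  intros Hf Hg.
  assert (Hfst : forall p : prod_UniformSpace R_UniformSpace R_UniformSpace,
    continuous (T := prod_UniformSpace R_UniformSpace R_UniformSpace) (U := R_UniformSpace) fst p).
  { intros [u v]. apply continuous_fst. }
  assert (Hsnd : forall p : prod_UniformSpace R_UniformSpace R_UniformSpace,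
    continuous (T := prod_UniformSpace R_UniformSpace R_UniformSpace) (U := R_UniformSpace) snd p).
  { intros [u v]. apply continuous_snd. }
  assert (H : forall h : X -> C, contC h -> (forall x,
    continuous (fun y => fst (h y)) x) /\ (forall x, continuous (fun y => snd (h y)) x)).
  { intros h Hh; split; intros x.
    - exact (continuous_comp (V := prod_UniformSpace R_UniformSpace R_UniformSpace)
      h fst x (Hh x) (Hfst (h x))).
    - exact (continuous_comp (V := prod_UniformSpace R_UniformSpace R_UniformSpace)
      h snd x (Hh x) (Hsnd (h x))). }
  destruct (H f Hf) as [f1 f2], (H g Hg) as [g1 g2].
  apply contC_pair; intros x.
  - apply (continuous_minus (V := R_NormedModule)); apply (continuous_mult (K := R_AbsRing)); auto.
  - apply (continuous_plus (V := R_NormedModule)); apply (continuous_mult (K := R_AbsRing)); auto.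
Qed.

(** Compactness of [[a, b]]: the moduli of continuity at the points [(t, x0)] can
    be chosen uniformly in [t]. *)
Lemma tube_lemma {X : UniformSpace} (F : R -> X -> C) (a b : R) (x0 : X) :
  contC (X := prod_UniformSpace R_UniformSpace X) (fun p => F (fst p) (snd p)) ->
  forall eps : posreal, exists d : posreal, forall t x,
    (a <= t <= b)%R -> ball x0 d x -> (Cmod (F t x - F t x0) < eps)%R.
Proof.
  intros HF eps.
  assert (He : (0 < eps / 2)%R) by (pose proof (cond_pos eps); lra).
  assert (Hd : forall t : R, exists d : posreal, forall s x, (Rabs (s - t) < d)%R -> ball x0 d x ->
     (Cmod (F s x - F t x0) < eps / 2)%R).
  { intros t.
    destruct (proj1 (continuous_C_eps _ _) (HF (t, x0)) (mkposreal _ He)) as [d Hd].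
    exists d. intros s x Hs Hx. apply (Hd (s, x)). now split. }
  pose (delta := fun t => proj1_sig (constructive_indefinite_description _ (Hd t))).
  assert (Hdelta : forall t s x, (Rabs (s - t) < delta t)%R -> ball x0 (delta t) x ->
     (Cmod (F s x - F t x0) < eps / 2)%R).
  { intros t. unfold delta. now destruct (constructive_indefinite_description _ (Hd t)). }
  destruct (compactness_value_1d a b delta) as [d Hcomp].
  exists d. intros t x Ht Hx. apply Rnot_le_lt. intros Hcontra.
  apply (Hcomp t Ht). intros (u & _ & Htu & Hdu).
  apply (Rle_not_lt _ _ Hcontra).
  pose proof (Hdelta u t x Htu (ball_le x0 d (delta u) Hdu x Hx)) as H1.
  pose proof (Hdelta u t x0 Htu (ball_center x0 (delta u))) as H2.
  replace (F t x - F t x0) with ((F t x - F u x0) + - (F t x0 - F u x0)) by ring.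
  eapply Rle_lt_trans; [apply Cmod_triangle|]. rewrite Cmod_opp. lra.
Qed.

Lemma contC_slice {X : UniformSpace} (F : R -> X -> C) x :
  contC (X := prod_UniformSpace R_UniformSpace X) (fun p => F (fst p) (snd p)) ->
  contR (fun t => F t x).
Proof.
  intros HF t.
  apply (continuous_comp (V := prod_UniformSpace R_UniformSpace X) (W := C_UniformSpace)
    (fun t => (t, x)) (fun p => F (fst p) (snd p)) t); [|apply HF].
  apply continuous_pair; [apply continuous_id | apply continuous_const].
Qed.

Lemma cint_opp a b (f : R -> C) : contR f ->
  cint a b (fun t => - f t) = - cint a b f.
Proof.
  intros Hf. rewrite (cint_ext a b _ (fun t => (-(1)) * f t)) by (intros; ring).
  rewrite cint_scal by exact Hf. ring.
Qed.

Lemma contC_opp {X : UniformSpace} (f : X -> C) :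
  contC f -> contC (fun x => - f x).
Proof.
  intros Hf x. exact (continuous_opp (V := C_NormedModule) f x (Hf x)).
Qed.

Lemma cint_minus a b (f g : R -> C) : contR f -> contR g ->
  cint a b (fun t => f t - g t) = cint a b f - cint a b g.
Proof.
  intros Hf Hg. unfold Cminus. rewrite <- cint_opp by exact Hg.
  apply cint_plus; [exact Hf | now apply contC_opp].
Qed.

Lemma contC_minus {X : UniformSpace} (f g : X -> C) :
  contC f -> contC g -> contC (fun x => f x - g x).
Proof. intros Hf Hg. apply contC_plus; [exact Hf | now apply contC_opp]. Qed.

Lemma contC_cint {X : UniformSpace} (F : R -> X -> C) (a b : R) : (a <= b)%R ->
  contC (X := prod_UniformSpace R_UniformSpace X) (fun p => F (fst p) (snd p)) ->
  contC (fun x => cint a b (fun t => F t x)).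
Proof.
  intros Hab HF x0. apply continuous_C_eps. intros eps.
  assert (He : (0 < eps / (b - a + 1))%R) by (apply Rdiv_lt_0_compat; [apply cond_pos | lra]).
  destruct (tube_lemma F a b x0 HF (mkposreal _ He)) as [d Hd]. exists d. intros x Hx.
  rewrite <- cint_minus by (now apply contC_slice).
  apply Rle_lt_trans with ((b - a) * (eps / (b - a + 1)))%R.
  - apply cint_bound; [|exact Hab|].
    + apply (contC_minus (X := R_UniformSpace)); now apply contC_slice.
    + intros t Ht. left. now apply Hd.
  - apply Rlt_le_trans with ((b - a + 1) * (eps / (b - a + 1)))%R.
    + apply Rmult_lt_compat_r; lra.
    + right. field. lra.
Qed.
(** * The complex exponential *)

Definition cexp (z : C) : C :=
  ((exp (Re z) * cos (Im z))%R, (exp (Re z) * sin (Im z))%R).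

Lemma cexp_plus z w : cexp (z + w) = cexp z * cexp w.
Proof.
  destruct z as [a b], w as [c d]. unfold cexp, Re, Im, Cmult, Cplus; simpl.
  rewrite exp_plus, cos_plus, sin_plus. f_equal; ring.
Qed.

Lemma cexp_0 : cexp 0 = 1.
Proof.
  unfold cexp, Re, Im; simpl. rewrite exp_0, cos_0, sin_0. unfold RtoC. f_equal; ring.
Qed.

Lemma cexp_opp_l z : cexp (- z) * cexp z = 1.
Proof. rewrite <- cexp_plus, <- cexp_0. f_equal. ring. Qed.

Lemma Cmod_cexp z : Cmod (cexp z) = exp (Re z).
Proof.
  unfold cexp, Cmod; simpl.
  replace (_ + _)%R with (exp (Re z) * exp (Re z) * (Rsqr (sin (Im z)) + Rsqr (cos (Im z))))%R
    by (unfold Rsqr; ring).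
  rewrite sin2_cos2, Rmult_1_r. apply sqrt_square. left. apply exp_pos.
Qed.

Lemma cexp_period s : cexp (s, (2 * PI)%R) = cexp (s, 0%R).
Proof.
  unfold cexp; simpl. now rewrite cos_2PI, sin_2PI, cos_0, sin_0.
Qed.

Lemma derivable_pt_lim_0_eps f l : derivable_pt_lim f 0 l ->
  forall eps, (0 < eps)%R -> exists d : posreal, forall h, (Rabs h < d)%R ->
    (Rabs (f h - f 0 - l * h) <= eps * Rabs h)%R.
Proof.
  intros H eps He. destruct (H eps He) as [d Hd]. exists d. intros h Hh.
  destruct (Req_dec h 0) as [->|Hn].
  - replace (f 0 - f 0 - l * 0)%R with 0%R by ring. rewrite Rabs_R0. lra.
  - specialize (Hd h Hn Hh). rewrite Rplus_0_l in Hd.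
    replace (f h - f 0 - l * h)%R with (((f h - f 0) / h - l) * h)%R by (field; exact Hn).
    rewrite Rabs_mult. apply Rmult_le_compat_r; [apply Rabs_pos | lra].
Qed.

Lemma Cmod_le_Rabs (a b : R) : (Cmod (a, b) <= Rabs a + Rabs b)%R.
Proof.
  replace (a, b) with (RtoC a + Ci * RtoC b)
    by (unfold Ci, RtoC, Cplus, Cmult; simpl; f_equal; ring).
  eapply Rle_trans; [apply Cmod_triangle|].
  rewrite Cmod_mult, Cmod_Ci, !Cmod_R. lra.
Qed.

Lemma Rabs_Re_Im_le_Cmod (z : C) : (Rabs (Re z) <= Cmod z /\ Rabs (Im z) <= Cmod z)%R.
Proof.
  pose proof (Rmax_Cmod z). split; eapply Rle_trans; try exact H.
  - apply Rmax_l.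
  - apply Rmax_r.
Qed.

(** The real first-order expansions of exp, cos and sin at 0 bound both
    components of [cexp h - 1 - h]; elsewhere [cexp_plus] reduces to this point. *)
Lemma is_Cderive_cexp_0 : is_Cderive cexp 0 1.
Proof.
  apply is_Cderive_eps. intros eps.
  pose (e := Rmin (eps / 10) (1 / 2)).
  pose proof (cond_pos eps) as Heps.
  assert (He : (0 < e)%R) by (apply Rmin_pos; lra).
  assert (He1 : (e <= eps / 10)%R) by apply Rmin_l.
  assert (He2 : (e <= 1 / 2)%R) by apply Rmin_r.
  destruct (derivable_pt_lim_0_eps exp 1 derivable_pt_lim_exp_0 e He) as [d1 H1].
  pose proof (derivable_pt_lim_cos 0) as Hc. rewrite sin_0, Ropp_0 in Hc.
  destruct (derivable_pt_lim_0_eps cos 0 Hc e He) as [d2 H2].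
  pose proof (derivable_pt_lim_sin 0) as Hs. rewrite cos_0 in Hs.
  destruct (derivable_pt_lim_0_eps sin 1 Hs e He) as [d3 H3].
  pose (d := Rmin (Rmin d1 d2) (Rmin d3 e)).
  assert (Hd : (0 < d)%R) by (apply Rmin_pos; apply Rmin_pos; try apply cond_pos; exact He).
  assert (Hd' : (d <= d1 /\ d <= d2 /\ d <= d3 /\ d <= e)%R).
  { unfold d. pose proof (Rmin_l (Rmin d1 d2) (Rmin d3 e)).
    pose proof (Rmin_r (Rmin d1 d2) (Rmin d3 e)).
    pose proof (Rmin_l d1 d2). pose proof (Rmin_r d1 d2).
    pose proof (Rmin_l d3 e). pose proof (Rmin_r d3 e). lra. }
  exists (mkposreal d Hd). intros [x y] Hh. simpl in Hh.
  destruct (Rabs_Re_Im_le_Cmod (x, y)) as [Hx Hy]. simpl in Hx, Hy.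
  specialize (H1 x ltac:(lra)). specialize (H2 y ltac:(lra)). specialize (H3 y ltac:(lra)).
  rewrite exp_0 in H1. rewrite cos_0 in H2. rewrite sin_0 in H3.
  set (h := (x, y)) in *.
  assert (Hee : (Rabs (exp x - 1) <= 2 * Rabs x)%R).
  { replace (exp x - 1)%R with ((exp x - 1 - 1 * x) + x)%R by ring.
    eapply Rle_trans; [apply Rabs_triang|]. pose proof (Rabs_pos x). nra. }
  assert (He4 : (Rabs (exp x) <= 2)%R).
  { replace (exp x)%R with ((exp x - 1) + 1)%R by ring.
    eapply Rle_trans; [apply Rabs_triang|]. rewrite Rabs_R1. lra. }
  replace (cexp (0 + h) - cexp 0 - h * 1)
    with ((exp x * (cos y - 1 - 0 * y) + (exp x - 1 - 1 * x))%R,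
          (exp x * (sin y - 0 - 1 * y) + (exp x - 1) * y)%R).
  2:{ rewrite cexp_0, Cplus_0_l. unfold cexp, h, Re, Im, Cminus, Cplus, Copp, Cmult, RtoC; simpl.
      f_equal; ring. }
  eapply Rle_trans; [apply Cmod_le_Rabs|].
  pose proof (Rabs_triang (exp x * (cos y - 1 - 0 * y)) (exp x - 1 - 1 * x)) as T1.
  pose proof (Rabs_triang (exp x * (sin y - 0 - 1 * y)) ((exp x - 1) * y)) as T2.
  rewrite (Rabs_mult (exp x)) in T1, T2. rewrite (Rabs_mult (exp x - 1)) in T2.
  pose proof (Rabs_pos x). pose proof (Rabs_pos y). pose proof (Cmod_ge_0 h).
  pose proof (Rabs_pos (exp x)).
  assert (P1 : (Rabs (exp x) * Rabs (cos y - 1 - 0 * y) <= 2 * (e * Rabs y))%R)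
    by (apply Rmult_le_compat; try apply Rabs_pos; assumption).
  assert (P2 : (Rabs (exp x) * Rabs (sin y - 0 - 1 * y) <= 2 * (e * Rabs y))%R)
    by (apply Rmult_le_compat; try apply Rabs_pos; assumption).
  assert (P3 : (Rabs (exp x - 1) * Rabs y <= (2 * e) * Rabs y)%R)
    by (apply Rmult_le_compat_r; lra).
  assert (P4 : (e * Rabs x <= eps / 10 * Cmod h)%R) by (apply Rmult_le_compat; lra).
  assert (P5 : (e * Rabs y <= eps / 10 * Cmod h)%R) by (apply Rmult_le_compat; lra).
  assert (0 <= eps * Cmod h)%R by (apply Rmult_le_pos; lra).
  lra.
Qed.

Lemma entire_affine a b : entire (fun t => a * t + b).
Proof. intros z. exists a. apply is_derive_C_affine. Qed.

Lemma entire_ext f g : (forall z, f z = g z) -> entire f -> entire g.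
Proof. intros H Hf z. destruct (Hf z) as [l Hl]. exists l. now apply is_Cderive_ext with f. Qed.

Lemma entire_cexp : entire cexp.
Proof.
  intros z.
  assert (H : ex_Cderive (fun t => cexp z * cexp (1 * t + - z)) z).
  { eexists. apply is_Cderive_mult; [apply is_Cderive_const|].
    apply (is_Cderive_comp cexp); [|apply is_derive_C_affine].
    replace (1 * z + - z) with (RtoC 0) by ring. apply is_Cderive_cexp_0. }
  destruct H as [l Hl]. exists l. revert Hl. apply is_Cderive_ext. intros t.
  rewrite <- cexp_plus. f_equal. ring.
Qed.

(** * Goursat's theorem on rectangles *)

Definition hseg (k : C -> C) (y a b : R) : C := cint a b (fun x => k (x, y)).
Definition vseg (k : C -> C) (x c d : R) : C := cint c d (fun y => k (x, y)).

Definition rect (k : C -> C) (a b c d : R) : C :=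
  hseg k c a b - hseg k d a b + Ci * (vseg k b c d - vseg k a c d).

Lemma contC_hline (k : C -> C) y : contC (X := C_UniformSpace) k ->
  contR (fun x => k (x, y)).
Proof.
  intros Hk. apply (contC_comp (X := R_UniformSpace) k (fun x => (x, y)) Hk).
  apply contC_pair; intros x; [apply continuous_id | apply continuous_const].
Qed.

Lemma contC_vline (k : C -> C) x : contC (X := C_UniformSpace) k ->
  contR (fun y => k (x, y)).
Proof.
  intros Hk. apply (contC_comp (X := R_UniformSpace) k (fun y => (x, y)) Hk).
  apply contC_pair; intros y; [apply continuous_const | apply continuous_id].
Qed.

Lemma rect_split_h k a m b c d : contC (X := C_UniformSpace) k ->
  rect k a b c d = rect k a m c d + rect k m b c d.
Proof.
  intros Hk. unfold rect, hseg.
  rewrite <- (cint_Chasles a m b (fun x => k (x, c))) by (now apply contC_hline).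
  rewrite <- (cint_Chasles a m b (fun x => k (x, d))) by (now apply contC_hline).
  ring.
Qed.

Lemma rect_split_v k a b c m d : contC (X := C_UniformSpace) k ->
  rect k a b c d = rect k a b c m + rect k a b m d.
Proof.
  intros Hk. unfold rect, vseg.
  rewrite <- (cint_Chasles c m d (fun y => k (a, y))) by (now apply contC_vline).
  rewrite <- (cint_Chasles c m d (fun y => k (b, y))) by (now apply contC_vline).
  ring.
Qed.

Lemma rect_plus f g a b c d :
  contC (X := C_UniformSpace) f -> contC (X := C_UniformSpace) g ->
  rect (fun z => f z + g z) a b c d = rect f a b c d + rect g a b c d.
Proof.
  intros Hf Hg. unfold rect, hseg, vseg.
  pose proof (fun y => contC_hline f y Hf). pose proof (fun y => contC_hline g y Hg).
  pose proof (fun x => contC_vline f x Hf). pose proof (fun x => contC_vline g x Hg).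
  rewrite (cint_plus a b (fun x => f (x, c))), (cint_plus a b (fun x => f (x, d))),
    (cint_plus c d (fun y => f (a, y))), (cint_plus c d (fun y => f (b, y))) by auto.
  ring.
Qed.

Lemma cint_id a b : cint a b RtoC = (RtoC b * RtoC b - RtoC a * RtoC a) / 2.
Proof.
  rewrite (cint_derive (fun t => RtoC (t * t / 2)) RtoC).
  - rewrite !RtoC_div, !RtoC_mult by lra. field.
  - intros x. apply is_derive_RC. intros eps. exists eps. intros u Hu.
    rewrite <- RtoC_mult, <- !RtoC_minus, Cmod_R.
    replace ((x + u) * (x + u) / 2 - x * x / 2 - u * x)%R with (u / 2 * u)%R by field.
    rewrite Rabs_mult. apply Rmult_le_compat_r; [apply Rabs_pos|].
    unfold Rdiv. rewrite Rabs_mult, (Rabs_pos_eq (/ 2)) by lra. pose proof (Rabs_pos u). lra.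
  - intros x. apply (contC_pair (X := R_UniformSpace)); intros y;
      [apply continuous_id | apply continuous_const].
Qed.

Lemma contC_RtoC : contR RtoC.
Proof.
  apply contC_pair; intros y; [apply continuous_id | apply continuous_const].
Qed.

Lemma C_pair_eq (x y : R) : (x, y) = RtoC x + Ci * RtoC y.
Proof. unfold Ci, RtoC, Cplus, Cmult; simpl; f_equal; ring. Qed.

(** The linear part of [k] at a point contributes nothing to the integral over a
    small rectangle around it, so only the error term of the derivative does. *)
Lemma rect_affine al be a b c d : rect (fun z => al + be * z) a b c d = 0.
Proof.
  unfold rect, hseg, vseg.
  assert (Hh : forall y a b, cint a b (fun x => al + be * (x, y)) =
    (b - a)%R * (al + be * Ci * RtoC y) + be * ((RtoC b * RtoC b - RtoC a * RtoC a) / 2)).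
  { intros y a' b'. rewrite <- cint_id, <- cint_const, <- cint_scal, <- cint_plus.
    - apply cint_ext. intros t. rewrite C_pair_eq. ring.
    - apply (contC_const (X := R_UniformSpace)).
    - apply (contC_mult (X := R_UniformSpace));
      [apply (contC_const (X := R_UniformSpace)) | apply contC_RtoC].
    - apply contC_RtoC. }
  assert (Hv : forall x a b, cint a b (fun y => al + be * (x, y)) =
    (b - a)%R * (al + be * RtoC x) + (be * Ci) * ((RtoC b * RtoC b - RtoC a * RtoC a) / 2)).
  { intros y a' b'. rewrite <- cint_id, <- cint_const, <- cint_scal, <- cint_plus.
    - apply cint_ext. intros t. rewrite C_pair_eq. ring.
    - apply (contC_const (X := R_UniformSpace)).
    - apply (contC_mult (X := R_UniformSpace));
      [apply (contC_const (X := R_UniformSpace)) | apply contC_RtoC].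
    - apply contC_RtoC. }
  rewrite !Hh, !Hv, !RtoC_minus. ring.
Qed.

Lemma rect_bound k a b c d M : contC (X := C_UniformSpace) k -> (a <= b)%R -> (c <= d)%R ->
  (forall x y, (a <= x <= b)%R -> (c <= y <= d)%R -> (Cmod (k (x, y)) <= M)%R) ->
  (Cmod (rect k a b c d) <= 2 * ((b - a) + (d - c)) * M)%R.
Proof.
  intros Hk Hab Hcd HM. unfold rect, hseg, vseg, Cminus.
  assert (H1 : forall y, (c <= y <= d)%R -> (Cmod (cint a b (fun x => k (x, y))) <= (b - a) * M)%R).
  { intros y Hy. apply cint_bound; auto. now apply contC_hline. }
  assert (H2 : forall x, (a <= x <= b)%R -> (Cmod (cint c d (fun y => k (x, y))) <= (d - c) * M)%R).
  { intros y Hy. apply cint_bound; auto. now apply contC_vline. }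
  eapply Rle_trans; [apply Cmod_triangle|]. rewrite Cmod_mult, Cmod_Ci, Rmult_1_l.
  pose proof (Cmod_triangle (cint a b (fun x => k (x, c))) (- cint a b (fun x => k (x, d)))) as T1.
  pose proof (Cmod_triangle (cint c d (fun y => k (b, y))) (- cint c d (fun y => k (a, y)))) as T2.
  rewrite Cmod_opp in T1, T2.
  pose proof (H1 c ltac:(lra)). pose proof (H1 d ltac:(lra)).
  pose proof (H2 a ltac:(lra)). pose proof (H2 b ltac:(lra)). lra.
Qed.

Lemma Cmod_half (x y : C) (M : R) :
  (M <= Cmod (x + y))%R -> {(M <= 2 * Cmod x)%R} + {(M <= 2 * Cmod y)%R}.
Proof.
  intros H. pose proof (Cmod_triangle x y).
  destruct (Rle_dec M (2 * Cmod x)); [now left | right; lra].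
Qed.

(** Among the four quarters of a rectangle, one carries at least a
    quarter of the integral.  A quarter is recorded by its lower-left corner,
    all the rectangles of step [n] having the sides [dyadic n lx], [dyadic n ly]. *)
Section Bisection.
Variables (k : C -> C) (a0 c0 lx ly : R).
Hypothesis Hk : contC (X := C_UniformSpace) k.

Definition dyadic (n : nat) (l : R) : R := (l / 2 ^ n)%R.

Definition cell (n : nat) (p : R * R) : C :=
  rect k (fst p) (fst p + dyadic n lx) (snd p) (snd p + dyadic n ly).

Lemma dyadic_S n l : dyadic n l = (2 * dyadic (S n) l)%R.
Proof. unfold dyadic. simpl. field. apply pow_nonzero. lra. Qed.

Lemma bisect n p : exists p' : R * R,
  (Cmod (cell n p) <= 4 * Cmod (cell (S n) p'))%R /\
  (fst p' = fst p \/ fst p' = fst p + dyadic (S n) lx)%R /\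
  (snd p' = snd p \/ snd p' = snd p + dyadic (S n) ly)%R.
Proof.
  destruct p as [a c]. unfold cell; simpl.
  rewrite (dyadic_S n lx), (dyadic_S n ly).
  set (x := dyadic (S n) lx). set (y := dyadic (S n) ly).
  assert (Hv : forall a', exists c', (c' = c \/ c' = c + y)%R /\
    (Cmod (rect k a' (a' + x) c (c + 2 * y)) <= 2 * Cmod (rect k a' (a' + x) c' (c' + y)))%R).
  { intros a'.
    pose proof (Req_le _ _ (f_equal Cmod (rect_split_v k a' (a' + x) c (c + y) (c + 2 * y)
      Hk))) as H.
    destruct (Cmod_half _ _ _ H) as [H'|H'].
    - exists c. split; [now left | exact H'].
    - exists (c + y)%R. split; [now right|].
      now replace (c + y + y)%R with (c + 2 * y)%R by ring. }
  assert (H := Req_le _ _ (f_equal Cmod (rect_split_h k a (a + x) (a + 2 * x) c (c + 2 * y) Hk))).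
  destruct (Cmod_half _ _ _ H) as [H'|H'].
  - destruct (Hv a) as (c' & Hc & Hc'). exists (a, c'). simpl. repeat split; auto. lra.
  - replace (a + 2 * x)%R with ((a + x) + x)%R in H' at 2 by ring.
    destruct (Hv (a + x)%R) as (c' & Hc & Hc'). exists ((a + x)%R, c'). simpl.
    repeat split; auto. lra.
Qed.

Fixpoint corner (n : nat) : R * R :=
  match n with
  | O => (a0, c0)
  | S n => proj1_sig (constructive_indefinite_description _ (bisect n (corner n)))
  end.

Lemma corner_S n :
  (Cmod (cell n (corner n)) <= 4 * Cmod (cell (S n) (corner (S n))))%R /\
  (fst (corner (S n)) = fst (corner n) \/ fst (corner (S n)) = fst (corner n) + dyadic (S n)
    lx)%R /\
  (snd (corner (S n)) = snd (corner n) \/ snd (corner (S n)) = snd (corner n) + dyadic (S n) ly)%R.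
Proof.
  simpl. destruct (constructive_indefinite_description _ (bisect n (corner n))) as [p Hp].
  exact Hp.
Qed.

Lemma cell_corner n : (Cmod (cell 0 (corner 0)) <= 4 ^ n * Cmod (cell n (corner n)))%R.
Proof.
  induction n as [|n IH]; [simpl; lra|].
  destruct (corner_S n) as [H _]. pose proof (pow_lt 4 n ltac:(lra)). simpl pow. nra.
Qed.
End Bisection.

(** The nested closed intervals [[u n, u n + dyadic n l]] share a point, which is
    the supremum of their left ends. *)
Lemma nested_limit (u : nat -> R) (l : R) : (0 <= l)%R ->
  (forall n, u (S n) = u n \/ u (S n) = u n + dyadic (S n) l)%R ->
  exists p, forall n, (u n <= p <= u n + dyadic n l)%R.
Proof.
  intros Hl H.
  assert (Hs : forall n, (0 <= dyadic n l)%R).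
  { intros n. unfold dyadic. apply Rmult_le_pos;
    [exact Hl|]. left. apply Rinv_0_lt_compat, pow_lt. lra. }
  assert (Hmono : forall n m, (u n <= u (n + m)%nat /\ u (n + m)%nat + dyadic (n + m)
    l <= u n + dyadic n l)%R).
  { intros n m. induction m as [|m IH].
    - rewrite Nat.add_0_r. lra.
    - rewrite Nat.add_succ_r. specialize (H (n + m)%nat).
      pose proof (dyadic_S (n + m) l). pose proof (Hs (S (n + m))). lra. }
  assert (Hnm : forall n m, (u n <= u m + dyadic m l)%R).
  { intros n m. destruct (Nat.le_ge_cases n m) as [Hle|Hle].
    - replace m with (n + (m - n))%nat by lia.
      pose proof (Hmono n (m - n)%nat). pose proof (Hs (n + (m - n))%nat). lra.
    - replace n with (m + (n - m))%nat by lia.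
      pose proof (Hmono m (n - m)%nat). pose proof (Hs (m + (n - m))%nat). lra. }
  destruct (completeness (fun x => exists n, x = u n)) as [p [Hp1 Hp2]].
  - exists (u 0%nat + dyadic 0 l)%R. intros x [n ->]. apply Hnm.
  - exists (u 0%nat). now exists 0%nat.
  - exists p. intros n. split.
    + apply Hp1. now exists n.
    + apply Hp2. intros x [m ->]. apply Hnm.
Qed.

(** At step [n] of the bisection around [p], the integral is at most
    [eps * (perimeter) * (diameter) = O(eps / 4^n)] by differentiability at [p],
    while bisection keeps at least [1 / 4^n] of the initial integral. *)
Lemma goursat k a b c d : entire k -> (a <= b)%R -> (c <= d)%R -> rect k a b c d = 0.
Proof.
  intros Hent Hab Hcd. pose proof (entire_contC k Hent) as Hk.
  set (lx := (b - a)%R). set (ly := (d - c)%R).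
  assert (Hlx : (0 <= lx)%R) by (unfold lx; lra).
  assert (Hly : (0 <= ly)%R) by (unfold ly; lra).
  pose (cor := corner k a c lx ly Hk).
  destruct (nested_limit (fun n => fst (cor n)) lx Hlx) as [x0 Hx0].
  { intros n. apply (corner_S k a c lx ly Hk n). }
  destruct (nested_limit (fun n => snd (cor n)) ly Hly) as [y0 Hy0].
  { intros n. apply (corner_S k a c lx ly Hk n). }
  destruct (Hent (x0, y0)) as [l Hl]. rewrite is_Cderive_eps in Hl.
  set (L := (lx + ly)%R) in *.
  assert (HL : (0 <= L)%R) by (unfold L; lra).
  assert (Haff : forall al be, entire (fun z => al + be * z)).
  { intros al be. apply entire_plus; [apply entire_const|].
    apply entire_mult; [apply entire_const | apply entire_id]. }
  assert (Hbound : forall eps : posreal, (Cmod (rect k a b c d) <= 2 * L * L * eps)%R).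
  { intros eps. destruct (Hl eps) as [del Hdel].
    assert (Hn : exists n, (dyadic n L < del)%R).
    { destruct (pow_lt_1_zero (1/2) ltac:(rewrite Rabs_pos_eq; lra) (del / (L + 1))) as [n Hn].
      - apply Rdiv_lt_0_compat; [apply cond_pos|lra].
      - exists n. specialize (Hn n (Nat.le_refl n)).
        rewrite Rabs_pos_eq in Hn by (apply pow_le; lra).
        unfold dyadic, Rdiv. replace (1 / 2)%R with (/ 2)%R in Hn by field.
        rewrite pow_inv in Hn.
        assert (0 < / 2 ^ n)%R by (apply Rinv_0_lt_compat, pow_lt; lra).
        apply Rle_lt_trans with ((L + 1) * / 2 ^ n)%R; [nra|].
        apply (Rmult_lt_compat_l (L + 1)) in Hn; [|lra].
        replace ((L + 1) * (del / (L + 1)))%R with (pos del) in Hn by (field; lra). lra. }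
    destruct Hn as [n Hn].
    assert (Hsz : (dyadic n L = dyadic n lx + dyadic n ly)%R) by (unfold dyadic, L; field;
      apply pow_nonzero; lra).
    assert (Hsp : forall l, (0 <= l)%R -> (0 <= dyadic n l)%R).
    { intros l' Hl'. apply Rmult_le_pos; [exact Hl'|]. left. apply Rinv_0_lt_compat, pow_lt. lra. }
    pose proof (Hsp lx Hlx). pose proof (Hsp ly Hly).
    pose proof (cell_corner k a c lx ly Hk n) as Hc.
    fold cor in Hc. specialize (Hx0 n). specialize (Hy0 n).
    destruct (cor n) as [an cn] eqn:Ecor. simpl fst in *. simpl snd in *.
    unfold cell at 1 in Hc. simpl in Hc.
    replace (a + dyadic 0 lx)%R with b in Hc by (unfold dyadic, lx; simpl; field).
    replace (c + dyadic 0 ly)%R with d in Hc by (unfold dyadic, ly; simpl; field).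
    set (p := (x0, y0)) in *.
    assert (Hcell : (Cmod (cell k lx ly n (an, cn)) <= 2 * dyadic n L * (eps * dyadic n L))%R).
    { unfold cell; simpl fst; simpl snd.
      assert (E : rect k an (an + dyadic n lx) cn (cn + dyadic n ly) =
        rect (fun z => k z + ((- k p + p * l) + (- l) * z)) an (an + dyadic n lx)
          cn (cn + dyadic n ly)).
      { rewrite (rect_plus k (fun z => (- k p + p * l) + (- l) * z));
          [|exact Hk | apply entire_contC, Haff].
        rewrite rect_affine. ring. }
      rewrite E. rewrite Hsz at 1.
      replace (dyadic n lx + dyadic n ly)%R with
        ((an + dyadic n lx - an) + (cn + dyadic n ly - cn))%R by ring.
      apply rect_bound; [| lra | lra |].
      - apply entire_contC, entire_plus; [exact Hent | apply Haff].
      - intros x y Hx Hy. set (h := (x, y) - p).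
        assert (Hh : (Cmod h <= dyadic n L)%R).
        { unfold h, p. replace ((x, y) - (x0, y0)) with ((x - x0)%R, (y - y0)%R) by reflexivity.
          eapply Rle_trans; [apply Cmod_le_Rabs|]. rewrite Hsz.
          apply Rplus_le_compat; apply Rabs_le; lra. }
        specialize (Hdel h ltac:(lra)).
        assert (E1 : forall u v : C, u + (v - u) = v) by (intros; ring).
        assert (E2 : forall u v kv ku : C,
          kv + (- ku + u * l + - l * v) = kv - ku - (v - u) * l) by (intros; ring).
        rewrite (E2 p (x, y) (k (x, y)) (k p)).
        unfold h at 1 in Hdel. rewrite E1 in Hdel.
        eapply Rle_trans; [exact Hdel|].
        apply Rmult_le_compat_l; [left; apply cond_pos | exact Hh]. }
    eapply Rle_trans; [exact Hc|].
    eapply Rle_trans; [apply Rmult_le_compat_l; [apply pow_le; lra | exact Hcell]|].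
    right. unfold dyadic. replace 4%R with (2 * 2)%R by ring. rewrite Rpow_mult_distr. field.
    apply pow_nonzero. lra. }
  apply (Cmod_le_eps_0 _ (2 * L * L)); [nra | exact Hbound].
Qed.
Lemma cexp_neq_0 z : cexp z <> 0.
Proof. apply Cmod_gt_0. rewrite Cmod_cexp. apply exp_pos. Qed.

Lemma cexp_opp z : cexp (- z) = / cexp z.
Proof.
  rewrite <- (Cmult_1_r (cexp (- z))), <- (Cinv_r (cexp z)) by apply cexp_neq_0.
  rewrite Cmult_assoc, cexp_opp_l. ring.
Qed.

(** * The integral formula for the derivative *)

(** Up to the factor [i], this is the Cauchy integrand [g(u) / (u - w)^2 du] for
    [g'(w)] on the circle [u = w + e^z], [z = s + i t], of radius [e^s]. *)
Definition circle_integrand (g : C -> C) (w z : C) : C := g (w + cexp z) * cexp (- z).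

Lemma entire_circle_integrand g w : entire g -> entire (circle_integrand g w).
Proof.
  intros Hg. apply entire_mult.
  - apply (entire_comp g (fun z => w + cexp z) Hg).
    apply entire_plus; [apply entire_const | apply entire_cexp].
  - apply (entire_comp cexp); [apply entire_cexp | apply entire_opp, entire_id].
Qed.

(** The two horizontal sides of the rectangle cancel by periodicity. *)
Lemma circle_int_const_le g w s1 s2 : entire g -> (s1 <= s2)%R ->
  vseg (circle_integrand g w) s1 0 (2 * PI) = vseg (circle_integrand g w) s2 0 (2 * PI).
Proof.
  intros Hg Hs. pose proof PI_RGT_0.
  pose proof (goursat (circle_integrand g w) s1 s2 0 (2 * PI) (entire_circle_integrand g w Hg)
    Hs ltac:(lra)) as H0.
  unfold rect in H0.
  replace (hseg (circle_integrand g w) (2 * PI) s1 s2) with (hseg (circle_integrand g w)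
    0 s1 s2) in H0.
  2:{ apply cint_ext. intros x. unfold circle_integrand. now rewrite !cexp_opp, cexp_period. }
  set (A := vseg (circle_integrand g w) s1 0 (2 * PI)) in *.
  set (B := vseg (circle_integrand g w) s2 0 (2 * PI)) in *.
  set (D := hseg (circle_integrand g w) 0 s1 s2) in *.
  assert (HC : Ci * Ci = - (1)) by (unfold Ci, RtoC, Cmult, Copp; simpl; f_equal; ring).
  assert (E : B - A = - ((Ci * Ci) * (B - A))) by (rewrite HC; ring).
  replace (Ci * Ci * (B - A)) with (Ci * (D - D + Ci * (B - A))) in E by ring.
  rewrite H0 in E. symmetry. apply Ceq_minus. rewrite E. ring.
Qed.

Lemma circle_int_const g w s1 s2 : entire g ->
  vseg (circle_integrand g w) s1 0 (2 * PI) = vseg (circle_integrand g w) s2 0 (2 * PI).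
Proof.
  intros Hg. destruct (Rle_dec s1 s2).
  - now apply circle_int_const_le.
  - symmetry. apply circle_int_const_le; [exact Hg | lra].
Qed.

Lemma contR_cexp_opp s : contR (fun t => cexp (- (s, t))).
Proof.
  apply (contC_vline (fun z => cexp (- z))). apply entire_contC.
  apply (entire_comp cexp); [apply entire_cexp | apply entire_opp, entire_id].
Qed.

(** For [g = 1] the integral does not depend on [s]; but it is also
    proportional to [e^(- s)], so it vanishes. *)
Lemma cint_cexp_opp s : cint 0 (2 * PI) (fun t => cexp (- (s, t))) = 0.
Proof.
  assert (H : forall u, cint 0 (2 * PI) (fun t => cexp (- (u, t))) =
    cexp (- RtoC u) * cint 0 (2 * PI) (fun t => cexp (- (0%R, t)))).
  { intros u. rewrite <- cint_scal by apply contR_cexp_opp. apply cint_ext. intros t.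
    rewrite <- cexp_plus. f_equal. rewrite !C_pair_eq. ring. }
  assert (H1 : forall u, cint 0 (2 * PI) (fun t => cexp (- (u, t))) =
    cint 0 (2 * PI) (fun t => cexp (- (0%R, t)))).
  { intros u. pose proof (circle_int_const (fun _ => 1) 0 u 0 (entire_const 1)) as E.
    unfold vseg, circle_integrand in E.
    rewrite (cint_ext _ _ _ (fun t => cexp (- (u, t)))) in E by (intros; ring).
    rewrite E. apply cint_ext. intros; ring. }
  rewrite H1. set (I := cint 0 (2 * PI) (fun t => cexp (- (0%R, t)))) in *.
  assert (E : (cexp (- RtoC 1) - 1) * I = 0).
  { transitivity (cexp (- RtoC 1) * I - I); [ring|]. rewrite <- H, H1. ring. }
  assert (Hn : cexp (- RtoC 1) - 1 <> 0).
  { intros Hc. assert (Hm : Cmod (cexp (- RtoC 1)) = 1%R).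
    { replace (cexp (- RtoC 1)) with (RtoC 1).
      - apply Cmod_1.
      - symmetry. now apply Ceq_minus. }
    rewrite Cmod_cexp in Hm. change (Re (- RtoC 1)) with (- 1)%R in Hm.
    pose proof (exp_increasing (-1) 0 ltac:(lra)) as Hlt. rewrite exp_0 in Hlt. lra. }
  replace I with (/ (cexp (- RtoC 1) - 1) * ((cexp (- RtoC 1) - 1) * I)).
  - rewrite E. ring.
  - rewrite Cmult_assoc, Cinv_l by exact Hn. ring.
Qed.

(** By [circle_int_const] it suffices to consider small circles, where [g] may be
    replaced by its first-order expansion at [w]: the constant term integrates
    to 0 by [cint_cexp_opp] and the linear one to [2 pi g'(w)]. *)
Lemma circle_derive g w s : entire g ->
  cint 0 (2 * PI) (fun t => g (w + cexp (s, t)) * cexp (- (s, t)))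
  = (2 * PI)%R * C_derive g w.
Proof.
  intros Hg. pose proof PI_RGT_0 as HPI.
  pose proof (Cderive_correct g w (Hg w)) as Hd.
  set (l := C_derive g w) in *.
  apply Ceq_minus. apply (Cmod_le_eps_0 _ (2 * PI)); [lra|]. intros eps.
  rewrite is_Cderive_eps in Hd. destruct (Hd eps) as [del Hdel].
  assert (Hdel2 : (0 < del / 2)%R) by (pose proof (cond_pos del); lra).
  (* The circle of radius [del / 2], inside the disc where the expansion holds. *)
  set (u := ln (del / 2)).
  change (cint 0 (2 * PI) _) with (vseg (circle_integrand g w) s 0 (2 * PI)).
  rewrite (circle_int_const g w s u Hg). unfold vseg.
  assert (Hk : contR (fun t => circle_integrand g w (u, t)))
    by (apply contC_vline, entire_contC, entire_circle_integrand, Hg).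
  assert (Hc : contR (fun t => g w * cexp (- (u, t)) + l)).
  { apply (contC_plus (X := R_UniformSpace)); [|apply (contC_const (X := R_UniformSpace))].
    apply (contC_mult (X := R_UniformSpace));
      [apply (contC_const (X := R_UniformSpace)) | apply contR_cexp_opp]. }
  replace ((2 * PI)%R * l) with (cint 0 (2 * PI) (fun t => g w * cexp (- (u, t)) + l)).
  2:{ rewrite (cint_plus 0 (2 * PI) (fun t => g w * cexp (- (u, t))) (fun _ => l)).
      - rewrite cint_scal, cint_cexp_opp, cint_const by apply contR_cexp_opp.
        rewrite Rminus_0_r. ring.
      - apply (contC_mult (X := R_UniformSpace));
        [apply (contC_const (X := R_UniformSpace)) | apply contR_cexp_opp].
      - apply (contC_const (X := R_UniformSpace)). }
  rewrite <- cint_minus by assumption.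
  replace (2 * PI * eps)%R with ((2 * PI - 0) * eps)%R by ring.
  apply cint_bound; [|lra|].
  - now apply (contC_minus (X := R_UniformSpace)).
  - intros t _. unfold circle_integrand.
    assert (Hmod : Cmod (cexp (u, t)) = (del / 2)%R) by (rewrite Cmod_cexp; now apply exp_ln).
    specialize (Hdel (cexp (u, t)) ltac:(rewrite Hmod; lra)).
    replace (g (w + cexp (u, t)) * cexp (- (u, t)) - (g w * cexp (- (u, t)) + l))
      with ((g (w + cexp (u, t)) - g w - cexp (u, t) * l) * cexp (- (u, t)))
      by (rewrite cexp_opp; field; apply cexp_neq_0).
    rewrite Cmod_mult, cexp_opp, Cmod_inv, Hmod by apply cexp_neq_0.
    rewrite Hmod in Hdel.
    apply (Rmult_le_compat_r (/ (del / 2))) in Hdel; [|left; now apply Rinv_0_lt_compat].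
    rewrite Rmult_assoc, Rinv_r in Hdel by lra. lra.
Qed.

Lemma is_derive_line g z h l : is_Cderive g z l -> forall z0 x, z = z0 + RtoC x * h ->
  is_derive (K := R_AbsRing) (V := C_R_NormedModule) (fun t => g (z0 + RtoC t * h)) x (h * l).
Proof.
  intros Hg z0 x ->. apply is_derive_RC. intros eps.
  pose proof (Cmod_ge_0 h) as Hh.
  assert (He : (0 < eps / (Cmod h + 1))%R) by (apply Rdiv_lt_0_compat; [apply cond_pos | lra]).
  rewrite is_Cderive_eps in Hg. destruct (Hg (mkposreal _ He)) as [d Hd]. simpl in Hd.
  assert (Hdp : (0 < d / (Cmod h + 1))%R) by (apply Rdiv_lt_0_compat; [apply cond_pos | lra]).
  exists (mkposreal _ Hdp). simpl. intros u Hu.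
  assert (Hm : Cmod (RtoC u * h) = (Rabs u * Cmod h)%R) by now rewrite Cmod_mult, Cmod_R.
  pose proof (Rabs_pos u).
  assert (Hlt : (Cmod (RtoC u * h) < d)%R).
  { rewrite Hm. apply Rle_lt_trans with (Rabs u * (Cmod h + 1))%R; [nra|].
    apply (Rmult_lt_compat_r (Cmod h + 1)) in Hu; [|lra].
    replace (d / (Cmod h + 1) * (Cmod h + 1))%R with (pos d) in Hu by (field; lra). exact Hu. }
  specialize (Hd _ Hlt). rewrite Hm in Hd.
  replace (z0 + RtoC (x + u)%R * h) with (z0 + RtoC x * h + RtoC u * h) by (rewrite RtoC_plus;
    ring).
  replace (RtoC u * (h * l)) with (RtoC u * h * l) by ring.
  eapply Rle_trans; [exact Hd|].
  replace (eps / (Cmod h + 1) * (Rabs u * Cmod h))%R with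
    (eps * Rabs u * (Cmod h / (Cmod h + 1)))%R by (field; lra).
  pose proof (Rdiv_plus_1_le (Cmod h) Hh).
  assert (0 <= eps * Rabs u)%R by (apply Rmult_le_pos; [left; apply cond_pos | assumption]).
  nra.
Qed.

Lemma contC_ext {X : UniformSpace} (f g : X -> C) :
  (forall x, f x = g x) -> contC f -> contC g.
Proof. intros H Hf x. apply (continuous_ext (U := C_UniformSpace) f g x H). apply Hf. Qed.

Lemma contC_continuous_comp {X Y : UniformSpace} (f : Y -> C) (g : X -> Y) :
  contC f -> (forall x, continuous g x) -> contC (fun x => f (g x)).
Proof.
  intros Hf Hg x.
  apply (continuous_comp (W := C_UniformSpace) g f x); [apply Hg|apply Hf].
Qed.

Lemma continuous_fst' {X Y : UniformSpace} (p : prod_UniformSpace X Y) :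
  continuous (T := prod_UniformSpace X Y) (U := X) fst p.
Proof. destruct p. apply continuous_fst. Qed.

Lemma continuous_snd' {X Y : UniformSpace} (p : prod_UniformSpace X Y) :
  continuous (T := prod_UniformSpace X Y) (U := Y) snd p.
Proof. destruct p. apply continuous_snd. Qed.

Definition jointly_continuous {X Y : UniformSpace} (F : X -> Y -> C) : Prop :=
  contC (X := prod_UniformSpace X Y) (fun p => F (fst p) (snd p)).

Lemma C_derive_circle g w : entire g ->
  C_derive g w = RtoC (/ (2 * PI)) * cint 0 (2 * PI) (fun t => g (w + cexp (0%R,
    t)) * cexp (- (0%R, t))).
Proof.
  intros Hg. pose proof PI_RGT_0. rewrite circle_derive by exact Hg.
  rewrite Cmult_assoc, <- RtoC_mult, Rinv_l by lra. ring.
Qed.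

Lemma contC_cexp_circle : contR (fun t => cexp (0%R, t)).
Proof. apply (contC_vline cexp). apply entire_contC, entire_cexp. Qed.

(** A derivative is an integral of values of the function, so it inherits their
    continuity in all the variables. *)
Lemma jointly_continuous_C_derive {X : UniformSpace} (G : X -> C -> C) :
  jointly_continuous (Y := C_UniformSpace) G -> (forall x, entire (G x)) ->
  jointly_continuous (Y := C_UniformSpace) (fun x w => C_derive (G x) w).
Proof.
  intros HG He. pose proof PI_RGT_0. unfold jointly_continuous.
  apply (contC_ext (X := prod_UniformSpace X C_UniformSpace)
    (fun p => RtoC (/ (2 * PI)) * cint 0 (2 * PI)
      (fun t => G (fst p) (snd p + cexp (0%R, t)) * cexp (- (0%R, t))))).
  { intros p. now rewrite <- C_derive_circle. }
  apply contC_mult; [apply contC_const|].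
  apply (contC_cint (X := prod_UniformSpace X C_UniformSpace)
    (fun t p => G (fst p) (snd p + cexp (0%R, t)) * cexp (- (0%R, t)))); [lra|].
  apply contC_mult.
  - apply (contC_continuous_comp (Y := prod_UniformSpace X C_UniformSpace)
      (fun p => G (fst p) (snd p)) (fun q => (fst (snd q), snd (snd q) + cexp (0%R, fst q))));
        [exact HG|].
    intros q. apply continuous_pair.
    + apply (continuous_comp snd fst); [apply continuous_snd' | apply continuous_fst'].
    + revert q. apply contC_plus.
      * intros q. apply (continuous_comp snd snd); apply continuous_snd'.
      * apply (contC_continuous_comp (Y := R_UniformSpace) (fun t => cexp (0%R,
        t)) fst contC_cexp_circle).
        intros q. apply continuous_fst'.
  - apply (contC_continuous_comp (Y := R_UniformSpace) (fun t => cexp (- (0%R,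
    t))) fst (contR_cexp_opp 0)).
    intros q. apply continuous_fst'.
Qed.

Lemma jointly_continuous_slice {X Y : UniformSpace} (G : X -> Y -> C) x :
  jointly_continuous G -> contC (G x).
Proof.
  intros HG.
  apply (contC_continuous_comp (Y := prod_UniformSpace X Y) (fun p => G (fst p) (snd p))
    (fun w => (x, w)) HG).
  intros w. apply continuous_pair; [apply continuous_const | apply continuous_id].
Qed.

Lemma increment_line g w h : entire g ->
  contC (X := C_UniformSpace) (C_derive g) ->
  g (w + h) - g w = h * cint 0 1 (fun s => C_derive g (w + RtoC s * h)).
Proof.
  intros Hg Hc.
  assert (Hline : contR (fun s => C_derive g (w + RtoC s * h))).
  { apply (contC_comp (X := R_UniformSpace) (C_derive g) (fun s => w + RtoC s * h) Hc).
    apply (contC_plus (X := R_UniformSpace)); [apply (contC_const (X := R_UniformSpace))|].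
    apply (contC_mult (X := R_UniformSpace));
      [apply contC_RtoC | apply (contC_const (X := R_UniformSpace))]. }
  rewrite <- cint_scal by exact Hline.
  rewrite (cint_derive (fun s => g (w + RtoC s * h))).
  - f_equal; [f_equal; ring | f_equal; f_equal; ring].
  - intros x. apply (is_derive_line g (w + RtoC x * h) h _ (Cderive_correct _ _ (Hg _))
    w x eq_refl).
  - apply (contC_mult (X := R_UniformSpace));
    [apply (contC_const (X := R_UniformSpace)) | exact Hline].
Qed.

(** Mean value inequality along the segment [[w, w + h]]. *)
Lemma increment_bound g w h l eps : entire g ->
  contC (X := C_UniformSpace) (C_derive g) ->
  (forall s, (0 <= s <= 1)%R -> (Cmod (C_derive g (w + RtoC s * h) - l) <= eps)%R) ->
  (Cmod (g (w + h)%C - g w - h * l) <= eps * Cmod h)%R.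
Proof.
  intros Hg Hc Hl.
  assert (Hline : contR (fun s => C_derive g (w + RtoC s * h))).
  { apply (contC_comp (X := R_UniformSpace) (C_derive g) (fun s => w + RtoC s * h) Hc).
    apply (contC_plus (X := R_UniformSpace)); [apply (contC_const (X := R_UniformSpace))|].
    apply (contC_mult (X := R_UniformSpace));
      [apply contC_RtoC | apply (contC_const (X := R_UniformSpace))]. }
  rewrite increment_line by assumption.
  replace (h * cint 0 1 (fun s => C_derive g (w + RtoC s * h)) - h * l)
    with (h * (cint 0 1 (fun s => C_derive g (w + RtoC s * h)) - cint 0 1 (fun _ => l))).
  2:{ rewrite cint_const, Rminus_0_r. ring. }
  rewrite <- cint_minus; [|exact Hline|apply (contC_const (X := R_UniformSpace))].
  rewrite Cmod_mult, Rmult_comm. apply Rmult_le_compat_r; [apply Cmod_ge_0|].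
  replace eps with ((1 - 0) * eps)%R by ring.
  apply cint_bound; [|lra|exact Hl].
  apply (contC_minus (X := R_UniformSpace));
    [exact Hline | apply (contC_const (X := R_UniformSpace))].
Qed.

Lemma entire_contC_derive g : entire g -> contC (X := C_UniformSpace) (C_derive g).
Proof.
  intros Hg. apply (jointly_continuous_slice (X := C_UniformSpace) (Y := C_UniformSpace)
    (fun _ => C_derive g) (RtoC 0)).
  apply jointly_continuous_C_derive; [|auto].
  apply (contC_continuous_comp (Y := C_UniformSpace) g snd (entire_contC g Hg)).
  intros q. apply continuous_snd'.
Qed.

(** Differentiation under the integral sign: [tube_lemma] makes the derivatives
    continuous in [w] uniformly in [t], hence the first-order expansions of
    the [G t] uniform by [increment_bound]. *)
Lemma entire_cint (G : R -> C -> C) a b : (a <= b)%R ->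
  jointly_continuous (X := R_UniformSpace) (Y := C_UniformSpace) G -> (forall t, entire (G t)) ->
  entire (fun w => cint a b (fun t => G t w)).
Proof.
  intros Hab HG He w.
  pose proof (jointly_continuous_C_derive (X := R_UniformSpace) G HG He) as HD.
  exists (cint a b (fun t => C_derive (G t) w)).
  apply is_Cderive_eps. intros eps.
  assert (Heps : (0 < eps / (b - a + 1))%R) by (apply Rdiv_lt_0_compat; [apply cond_pos | lra]).
  destruct (tube_lemma (X := C_UniformSpace) (fun t w => C_derive (G t) w)
    a b w HD (mkposreal _ Heps)) as [d Hd].
  exists d. intros h Hh.
  assert (HGc : forall z, contR (fun t => G t z)) by (intros z;
    now apply (contC_slice (X := C_UniformSpace) G)).
  assert (HDc : forall z, contR (fun t => C_derive (G t) z))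
    by (intros z; now apply (contC_slice (X := C_UniformSpace) (fun t w => C_derive (G t) w))).
  rewrite <- cint_scal by apply HDc.
  rewrite <- cint_minus by apply HGc.
  rewrite <- cint_minus.
  2:{ apply (contC_minus (X := R_UniformSpace)); apply HGc. }
  2:{ apply (contC_mult (X := R_UniformSpace));
    [apply (contC_const (X := R_UniformSpace)) | apply HDc]. }
  apply Rle_trans with ((b - a) * (eps / (b - a + 1) * Cmod h))%R.
  - apply cint_bound; [|exact Hab|].
    + apply (contC_minus (X := R_UniformSpace)).
      * apply (contC_minus (X := R_UniformSpace)); apply HGc.
      * apply (contC_mult (X := R_UniformSpace));
        [apply (contC_const (X := R_UniformSpace)) | apply HDc].
    + intros t Ht. apply increment_bound; [apply He | now apply entire_contC_derive|].
      intros s Hs. left. apply Hd; [exact Ht|].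
      apply (C_NormedModule_mixin_compat1 w (w + RtoC s * h) d).
      change (minus (w + RtoC s * h) w) with ((w + RtoC s * h) - w).
      replace ((w + RtoC s * h) - w) with (RtoC s * h) by ring.
      rewrite Cmod_mult, Cmod_R, Rabs_pos_eq by lra.
      pose proof (Cmod_ge_0 h). nra.
  - replace ((b - a) * (eps / (b - a + 1) * Cmod h))%R with
      (eps * Cmod h * ((b - a) / (b - a + 1)))%R by (field; lra).
    pose proof (Rdiv_plus_1_le (b - a) ltac:(lra)).
    assert (0 <= eps * Cmod h)%R by (apply Rmult_le_pos; [left; apply cond_pos | apply Cmod_ge_0]).
    nra.
Qed.
(** * Holomorphic functions of three variables *)

Definition C3_US : UniformSpace :=
  prod_UniformSpace (prod_UniformSpace C_UniformSpace C_UniformSpace) C_UniformSpace.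

Definition C3_NM : NormedModule C_AbsRing :=
  prod_NormedModule C_AbsRing
    (prod_NormedModule C_AbsRing C_NormedModule C_NormedModule) C_NormedModule.

Notation cont3 := (contC (X := C3_US)).

Definition separately_entire (f : C3 -> C) : Prop :=
  forall i p, entire (fun t => f (set_coord i t p)).

Lemma continuous_proj i p : continuous (T := C3_US) (U := C_UniformSpace) (proj i) p.
Proof.
  destruct i; unfold proj.
  - apply (continuous_comp (U := C3_US) (V := prod_UniformSpace C_UniformSpace C_UniformSpace)
    (W := C_UniformSpace) fst fst);
    apply continuous_fst'.
  - apply (continuous_comp (U := C3_US) (V := prod_UniformSpace C_UniformSpace C_UniformSpace)
    (W := C_UniformSpace) fst snd);
    [apply continuous_fst' | apply continuous_snd'].
  - apply continuous_snd'.
Qed.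

Lemma continuous_triple {X : UniformSpace} (a b c : X -> C) x :
  continuous (U := C_UniformSpace) a x -> continuous (U := C_UniformSpace) b x ->
  continuous (U := C_UniformSpace) c x ->
  continuous (U := C3_US) (fun y => (a y, b y, c y)) x.
Proof.
  intros Ha Hb Hc.
  apply (continuous_pair (Y := prod_UniformSpace C_UniformSpace C_UniformSpace)
    (Z := C_UniformSpace)); [|exact Hc].
  now apply continuous_pair.
Qed.

Lemma continuous_set_coord {X : UniformSpace} i (a : X -> C) (q : X -> C3) x :
  continuous (U := C_UniformSpace) a x -> continuous (U := C3_US) q x ->
  continuous (U := C3_US) (fun y => set_coord i (a y) (q y)) x.
Proof.
  intros Ha Hq.
  assert (H : forall j, continuous (U := C_UniformSpace) (fun y => proj j (q y)) x).
  { intros j. apply (continuous_comp (V := C3_US) (W := C_UniformSpace) q (proj j));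
    [exact Hq | apply continuous_proj]. }
  destruct i; apply continuous_triple; auto.
Qed.

Lemma holomorphic_cont f : holomorphic f -> cont3 f.
Proof.
  intros Hf p. exact (filterdiff_continuous (U := C3_NM) (V := C_NormedModule) f p (Hf p)).
Qed.

Lemma proj_set_coord i t p : proj i (set_coord i t p) = t.
Proof. now destruct i. Qed.

Lemma set_coord_set_coord i s t p : set_coord i s (set_coord i t p) = set_coord i s p.
Proof. now destruct i. Qed.

Lemma set_coord_proj i p : set_coord i (proj i p) p = p.
Proof. destruct p as [[a b] c]. now destruct i. Qed.

Definition unit_coord (i : coord) : C3 := set_coord i 1 (RtoC 0, RtoC 0, RtoC 0).

Lemma C3_ext (p q : C3) : (forall j, proj j p = proj j q) -> p = q.
Proof.
  intros H. destruct p as [[a b] c], q as [[a' b'] c'].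
  f_equal; [f_equal|]; [apply (H i0) | apply (H i1) | apply (H i2)].
Qed.

Lemma set_coord_increment i z h p :
  minus (G := C3_NM) (set_coord i (z + h) p) (set_coord i z p) = scal (V := C3_NM)
    (h : C_AbsRing) (unit_coord i).
Proof.
  apply C3_ext. intros j.
  transitivity (proj j (set_coord i (z + h) p) - proj j (set_coord i z p));
    [now destruct j|].
  transitivity (h * proj j (unit_coord i)); [|now destruct j].
  destruct i, j; simpl; ring.
Qed.

Lemma holomorphic_separately f : holomorphic f -> separately_entire f.
Proof.
  intros Hf i p z. destruct (Hf (set_coord i z p)) as [L [HL HF]].
  exists (L (unit_coord i)). apply is_Cderive_eps. intros eps.
  specialize (HF (set_coord i z p) (fun P HP => HP)).
  set (N := norm (V := C3_NM) (unit_coord i)).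
  assert (HN : (0 <= N)%R) by apply norm_ge_0.
  assert (He : (0 < eps / (N + 1))%R) by (apply Rdiv_lt_0_compat; [apply cond_pos | lra]).
  destruct (HF (mkposreal _ He)) as [d Hd]. simpl in Hd. exists d. intros h Hh.
  assert (Hball : ball (set_coord i z p : C3_US) d (set_coord i (z + h) p)).
  { assert (Hb : ball (z : C_UniformSpace) d (z + h)).
    { apply (C_NormedModule_mixin_compat1 z (z + h) d).
      change (Cmod ((z + h) - z) < d)%R. now replace (z + h - z) with h by ring. }
    destruct i; (split; [split|]); try exact Hb; apply ball_center. }
  specialize (Hd _ Hball).
  rewrite set_coord_increment in Hd.
  rewrite (linear_scal L HL) in Hd.
  eapply Rle_trans; [exact Hd|].
  assert (Hs : (norm (V := C3_NM) (scal (V := C3_NM) (h : C_AbsRing) (unit_coord i))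
    <= Cmod h * N)%R)
    by apply (norm_scal (V := C3_NM)).
  apply Rle_trans with (eps / (N + 1) * (Cmod h * N))%R.
  { apply Rmult_le_compat_l; [lra | exact Hs]. }
  replace (eps / (N + 1) * (Cmod h * N))%R with (eps * Cmod h * (N / (N + 1)))%R by (field; lra).
  pose proof (Rdiv_plus_1_le N HN).
  assert (0 <= eps * Cmod h)%R by (apply Rmult_le_pos; [left; apply cond_pos | apply Cmod_ge_0]).
  nra.
Qed.

Lemma cont3_partial f i : cont3 f -> separately_entire f -> cont3 (partial i f).
Proof.
  intros Hc Hs.
  assert (HJ : jointly_continuous (X := C3_US) (Y := C_UniformSpace)
    (fun x t => C_derive (fun t => f (set_coord i t x)) t)).
  { apply jointly_continuous_C_derive; [|intros x; apply Hs].
    apply (contC_continuous_comp (Y := C3_US) f (fun q => set_coord i (snd q) (fst q)) Hc).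
    intros q. apply continuous_set_coord; [apply continuous_snd' | apply continuous_fst']. }
  apply (contC_continuous_comp (X := C3_US) (Y := prod_UniformSpace C3_US C_UniformSpace)
    _ (fun p => (p, proj i p)) HJ).
  intros p. apply continuous_pair; [apply continuous_id | apply continuous_proj].
Qed.

Lemma norm_prod_le {U V : NormedModule C_AbsRing} (x : U) (y : V) :
  (norm x <= norm (V := prod_NormedModule C_AbsRing U V) (x, y) /\
   norm y <= norm (V := prod_NormedModule C_AbsRing U V) (x, y))%R.
Proof.
  change (norm (V := prod_NormedModule C_AbsRing U V) (x, y)) with (sqrt (norm x ^ 2 + norm y ^ 2)).
  pose proof (norm_ge_0 x). pose proof (norm_ge_0 y).
  split.
  - rewrite <- (sqrt_pow2 (norm x)) at 1 by assumption. apply sqrt_le_1_alt. nra.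
  - rewrite <- (sqrt_pow2 (norm y)) at 1 by assumption. apply sqrt_le_1_alt. nra.
Qed.

Lemma Cmod_proj_le_norm i (p : C3) : (Cmod (proj i p) <= norm (V := C3_NM) p)%R.
Proof.
  destruct p as [[a b] c].
  destruct (norm_prod_le (U := prod_NormedModule C_AbsRing C_NormedModule C_NormedModule)
    (V := C_NormedModule) (a, b) c) as [H1 H2].
  destruct (norm_prod_le (U := C_NormedModule) (V := C_NormedModule) a b) as [H3 H4].
  destruct i; simpl.
  - eapply Rle_trans; [exact H3 | exact H1].
  - eapply Rle_trans; [exact H4 | exact H1].
  - exact H2.
Qed.

Lemma is_linear_combination (c0 c1 c2 : C) :
  is_linear (U := C3_NM) (V := C_NormedModule)
    (fun p => proj i0 p * c0 + proj i1 p * c1 + proj i2 p * c2).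
Proof.
  split.
  - intros [[a b] c] [[a' b'] c'].
    change (@eq C ((a + a') * c0 + (b + b') * c1 + (c + c') * c2)
      ((a * c0 + b * c1 + c * c2) + (a' * c0 + b' * c1 + c' * c2))). ring.
  - intros k [[a b] c].
    change (@eq C ((k * a) * c0 + (k * b) * c1 + (k * c) * c2)
      (k * (a * c0 + b * c1 + c * c2))). ring.
  - pose proof (Cmod_ge_0 c0). pose proof (Cmod_ge_0 c1). pose proof (Cmod_ge_0 c2).
    exists (Cmod c0 + Cmod c1 + Cmod c2 + 1)%R. split; [lra|]. intros p.
    pose proof (Cmod_proj_le_norm i0 p). pose proof (Cmod_proj_le_norm i1 p).
    pose proof (Cmod_proj_le_norm i2 p). pose proof (norm_ge_0 (V := C3_NM) p).
    change (Cmod (proj i0 p * c0 + proj i1 p * c1 + proj i2 p * c2) <=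
      (Cmod c0 + Cmod c1 + Cmod c2 + 1) * norm (V := C3_NM) p)%R.
    eapply Rle_trans; [apply Cmod_triangle|].
    pose proof (Cmod_triangle (proj i0 p * c0) (proj i1 p * c1)) as T.
    rewrite !Cmod_mult in *. nra.
Qed.

(** The partial derivatives are continuous by [cont3_partial]; the increment of
    [f] is then split into three increments along the coordinate axes. *)
Lemma osgood f : cont3 f -> separately_entire f -> holomorphic f.
Proof.
  intros Hc Hs x.
  exists (fun p => proj i0 p * partial i0 f x + proj i1 p * partial i1 f x + proj i2 p *
    partial i2 f x).
  split; [apply is_linear_combination|].
  intros y Hy eps.
  apply (is_filter_lim_locally_unique (V := C3_NM)) in Hy. change C3 in y.
  change (x = y) in Hy. subst y.
  assert (He : (0 < eps / 3)%R) by (pose proof (cond_pos eps); lra).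
  assert (Hd : exists d : posreal, forall i y, ball (x : C3_US) d y ->
    (Cmod (partial i f y - partial i f x) < eps / 3)%R).
  { pose proof (fun i => proj1 (continuous_C_eps (X := C3_US) _ x) (cont3_partial f i Hc Hs x)
    (mkposreal _ He)) as H.
    destruct (H i0) as [d0 H0], (H i1) as [d1 H1], (H i2) as [d2 H2].
    assert (Hm : (0 < Rmin d0 (Rmin d1 d2))%R) by (repeat apply Rmin_pos; apply cond_pos).
    pose proof (Rmin_l d0 (Rmin d1 d2)). pose proof (Rmin_r d0 (Rmin d1 d2)).
    pose proof (Rmin_l d1 d2). pose proof (Rmin_r d1 d2).
    exists (mkposreal _ Hm). simpl. intros [] y Hy.
    - apply H0. eapply ball_le; [|exact Hy]. lra.
    - apply H1. eapply ball_le; [|exact Hy]. lra.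
    - apply H2. eapply ball_le; [|exact Hy]. lra. }
  destruct Hd as [d Hd].
  assert (Hd2 : (0 < d / 2)%R) by (pose proof (cond_pos d); lra).
  exists (mkposreal _ Hd2). intros y Hy. change C3 in y.
  pose proof (Cmod_proj_le_norm i0 (minus (G := C3_NM) y x)) as N0.
  pose proof (Cmod_proj_le_norm i1 (minus (G := C3_NM) y x)) as N1.
  pose proof (Cmod_proj_le_norm i2 (minus (G := C3_NM) y x)) as N2.
  change (Cmod (f y - f x - (proj i0 (minus (G := C3_NM) y x) * partial i0 f x
    + proj i1 (minus (G := C3_NM) y x) * partial i1 f x
    + proj i2 (minus (G := C3_NM) y x) * partial i2 f x))
    <= eps * norm (V := C3_NM) (minus (G := C3_NM) y x))%R.
  set (M := norm (V := C3_NM) (minus (G := C3_NM) y x)) in *.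
  destruct x as [[a b] c]. destruct y as [[a' b'] c'].
  change (proj i0 (minus (G := C3_NM) (a', b', c') (a, b, c))) with (a' - a) in *.
  change (proj i1 (minus (G := C3_NM) (a', b', c') (a, b, c))) with (b' - b) in *.
  change (proj i2 (minus (G := C3_NM) (a', b', c') (a, b, c))) with (c' - c) in *.
  destruct Hy as [[Ha Hb] Hc']. simpl in Ha, Hb, Hc'.
  assert (Hmono : forall u v : C, ball (u : C_UniformSpace) (d / 2)
    v -> ball (u : C_UniformSpace) d v).
  { intros u v. apply ball_le. lra. }
  assert (Hseg : forall (u v : C) s, (0 <= s <= 1)%R -> ball (u : C_UniformSpace) (d / 2) v ->
    ball (u : C_UniformSpace) d (u + RtoC s * (v - u))).
  { intros [u1 u2] [v1 v2] s Hs' [B1 B2].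
    change (Rabs (v1 - u1) < d / 2)%R in B1. change (Rabs (v2 - u2) < d / 2)%R in B2.
    pose proof (Rabs_pos (v1 - u1)). pose proof (Rabs_pos (v2 - u2)).
    split.
    - change (Rabs ((u1 + (s * (v1 - u1) - 0 * (v2 - u2))) - u1) < d)%R.
      replace ((u1 + (s * (v1 - u1) - 0 * (v2 - u2))) - u1)%R with (s * (v1 - u1))%R by ring.
      rewrite Rabs_mult, (Rabs_pos_eq s) by lra. nra.
    - change (Rabs ((u2 + (s * (v2 - u2) + 0 * (v1 - u1))) - u2) < d)%R.
      replace ((u2 + (s * (v2 - u2) + 0 * (v1 - u1))) - u2)%R with (s * (v2 - u2))%R by ring.
      rewrite Rabs_mult, (Rabs_pos_eq s) by lra. nra. }
  assert (I0 : (Cmod (f (a', b', c') - f (a, b', c') - (a' - a) * partial i0 f (a, b,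
    c)) <= eps / 3 * Cmod (a' - a))%R).
  { pose proof (increment_bound (fun t => f (t, b', c')) a (a' - a) (partial i0 f (a, b,
    c)) (eps / 3)
      (Hs i0 (a, b', c')) (entire_contC_derive _ (Hs i0 (a, b', c')))) as H.
    simpl in H. replace (a + (a' - a)) with a' in H by ring. apply H.
    intros s Hs'. left. apply (Hd i0 (a + RtoC s * (a' - a), b', c')).
    split; [split|]; simpl; auto. }
  assert (I1 : (Cmod (f (a, b', c') - f (a, b, c') - (b' - b) * partial i1 f (a, b,
    c)) <= eps / 3 * Cmod (b' - b))%R).
  { pose proof (increment_bound (fun t => f (a, t, c')) b (b' - b) (partial i1 f (a, b,
    c)) (eps / 3)
      (Hs i1 (a, b, c')) (entire_contC_derive _ (Hs i1 (a, b, c')))) as H.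
    simpl in H. replace (b + (b' - b)) with b' in H by ring. apply H.
    intros s Hs'. left. apply (Hd i1 (a, b + RtoC s * (b' - b), c')).
    split; [split|]; simpl; auto. apply ball_center. }
  assert (I2 : (Cmod (f (a, b, c') - f (a, b, c) - (c' - c) * partial i2 f (a, b,
    c)) <= eps / 3 * Cmod (c' - c))%R).
  { pose proof (increment_bound (fun t => f (a, b, t)) c (c' - c) (partial i2 f (a, b, c)) (eps / 3)
      (Hs i2 (a, b, c)) (entire_contC_derive _ (Hs i2 (a, b, c)))) as H.
    simpl in H. replace (c + (c' - c)) with c' in H by ring. apply H.
    intros s Hs'. left. apply (Hd i2 (a, b, c + RtoC s * (c' - c))).
    split; [split|]; simpl; auto; apply ball_center. }
  match goal with |- (Cmod ?X <= _)%R => replace X with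
    ((f (a', b', c') - f (a, b', c') - (a' - a) * partial i0 f (a, b, c))
    + (f (a, b', c') - f (a, b, c') - (b' - b) * partial i1 f (a, b, c))
    + (f (a, b, c') - f (a, b, c) - (c' - c) * partial i2 f (a, b, c))) by ring end.
  eapply Rle_trans; [apply Cmod_triangle|].
  eapply Rle_trans; [apply Rplus_le_compat_r, Cmod_triangle|].
  nra.
Qed.

Lemma holomorphic_comp f a b c : holomorphic f -> holomorphic a -> holomorphic b ->
  holomorphic c -> holomorphic (fun p => f (a p, b p, c p)).
Proof.
  intros Hf Ha Hb Hc p.
  destruct (Ha p) as [la Ha'], (Hb p) as [lb Hb'], (Hc p) as [lc Hc'].
  destruct (Hf (a p, b p, c p)) as [lf Hf'].
  assert (Hpair : forall (U V : NormedModule C_AbsRing) (g : C3_NM -> U) (h : C3_NM -> V) lg lh,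
    filterdiff g (locally (p : C3_NM)) lg -> filterdiff h (locally (p : C3_NM)) lh ->
    filterdiff (V := prod_NormedModule C_AbsRing U V) (fun y => (g y,
      h y)) (locally (p : C3_NM)) (fun y => (lg y, lh y))).
  { intros U V g h lg lh Hg Hh.
    apply (filterdiff_comp'_2 (T := C3_NM) (U := U) (V := V)
      (W := prod_NormedModule C_AbsRing U V) g h (fun u v => (u, v)) p lg lh (fun u v => (u,
      v)) Hg Hh).
    apply filterdiff_ext_lin with (fun t => t).
    - apply filterdiff_ext with (fun t => t); [now intros []|]. apply filterdiff_id.
    - now intros []. }
  exists (fun y => lf (la y, lb y, lc y)).
  apply (filterdiff_comp' (U := C3_NM) (V := C3_NM) (W := C_NormedModule) (fun y => (a y, b y,
    c y)) f p (fun y => (la y, lb y, lc y)) lf); [|exact Hf'].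
  apply (Hpair (prod_NormedModule C_AbsRing C_NormedModule C_NormedModule)
    C_NormedModule (fun y => (a y, b y)) c); [|exact Hc'].
  now apply (Hpair C_NormedModule C_NormedModule a b).
Qed.

Lemma holomorphic_plus f g : holomorphic f -> holomorphic g ->
  holomorphic (fun p => f p + g p).
Proof.
  intros Hf Hg p. destruct (Hf p) as [lf Hf'], (Hg p) as [lg Hg'].
  exists (fun y => plus (G := C_NormedModule) (lf y) (lg y)).
  exact (filterdiff_plus_fct (V := C_NormedModule) f g lf lg Hf' Hg').
Qed.

Lemma holomorphic_mult f g : holomorphic f -> holomorphic g ->
  holomorphic (fun p => f p * g p).
Proof.
  intros Hf Hg p. destruct (Hf p) as [lf Hf'], (Hg p) as [lg Hg'].
  exists (fun y => plus (G := C_AbelianGroup) (lf y * g p) (f p * lg y)).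
  apply filterdiff_AbsRing_C in Hf', Hg'. apply filterdiff_AbsRing_C.
  exact (filterdiff_mult_fct (K := C_AbsRing) (U := C3_NM) f g p lf lg Cmult_comm Hf' Hg').
Qed.

Lemma holomorphic_minus f g : holomorphic f -> holomorphic g ->
  holomorphic (fun p => f p - g p).
Proof.
  intros Hf Hg. apply holomorphic_plus; [exact Hf | now apply holomorphic_opp].
Qed.

Lemma holomorphic_set_coord f i a : holomorphic f -> holomorphic a ->
  holomorphic (fun p => f (set_coord i (a p) p)).
Proof.
  intros Hf Ha. destruct i; apply (holomorphic_comp f); auto;
    first [exact (holomorphic_proj i0) | exact (holomorphic_proj i1) | exact (holomorphic_proj i2)].
Qed.

Lemma holomorphic_cint (F : R -> C3 -> C) a b : (a <= b)%R ->
  jointly_continuous (X := R_UniformSpace) (Y := C3_US) F -> (forall t, holomorphic (F t)) ->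
  holomorphic (fun x => cint a b (fun t => F t x)).
Proof.
  intros Hab HF Hh. apply osgood.
  - now apply contC_cint.
  - intros i p. apply (entire_cint (fun t s => F t (set_coord i s p)) a b Hab).
    + apply (contC_continuous_comp (Y := prod_UniformSpace R_UniformSpace C3_US)
      (fun q => F (fst q) (snd q))
        (fun q => (fst q, set_coord i (snd q) p)) HF).
      intros q. apply (continuous_pair (Z := C3_US)); [apply continuous_fst'|].
      apply continuous_set_coord; [apply continuous_snd' | apply continuous_const].
    + intros t. now apply holomorphic_separately.
Qed.

(** The integral formula for the derivative, along the [i]-th coordinate. *)
Lemma holomorphic_partial f i : holomorphic f -> holomorphic (partial i f).
Proof.
  intros Hf. pose proof PI_RGT_0.
  apply holomorphic_ext with (fun x => RtoC (/ (2 * PI)) * cint 0 (2 * PI)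
    (fun t => f (set_coord i (proj i x + cexp (0%R, t)) x) * cexp (- (0%R, t)))).
  { intros x. symmetry. apply (C_derive_circle (fun t => f (set_coord i t x))).
    now apply holomorphic_separately. }
  apply holomorphic_mult; [apply holomorphic_const|].
  apply (holomorphic_cint (fun t x => f (set_coord i (proj i x + cexp (0%R,
    t)) x) * cexp (- (0%R, t)))); [lra| |].
  - apply contC_mult.
    + apply (contC_continuous_comp (Y := C3_US) f (fun q => set_coord i (proj i (snd q)
      + cexp (0%R, fst q)) (snd q)) (holomorphic_cont f Hf)).
      intros q. apply continuous_set_coord; [|apply continuous_snd'].
      revert q. apply contC_plus.
      * apply (contC_continuous_comp (Y := C3_US) (proj i)
        snd (continuous_proj i)). intros q. apply continuous_snd'.
      * apply (contC_continuous_comp (Y := R_UniformSpace) (fun t => cexp (0%R,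
        t)) fst contC_cexp_circle).
        intros q. apply continuous_fst'.
    + apply (contC_continuous_comp (Y := R_UniformSpace) (fun t => cexp (- (0%R,
      t))) fst (contR_cexp_opp 0)).
      intros q. apply continuous_fst'.
  - intros t. apply holomorphic_mult; [|apply holomorphic_const].
    apply (holomorphic_set_coord f i (fun x => proj i x + cexp (0%R, t)) Hf).
    apply holomorphic_plus; [apply holomorphic_proj | apply holomorphic_const].
Qed.

Lemma partial_set_coord i s f p :
  partial i f (set_coord i s p) = C_derive (fun t => f (set_coord i t p)) s.
Proof. now destruct i. Qed.

(** The quotient is the integral over [0 <= t <= 1] of [d_i f] at the point [x]
    with [x_i] replaced by [t x_i], which is holomorphic across [x_i = 0]. *)
Lemma hadamard i f : holomorphic f -> exists h, holomorphic h /\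
  forall x, f x - f (set_coord i 0 x) = proj i x * h x.
Proof.
  intros Hf.
  pose proof (holomorphic_partial f i Hf) as Hp.
  exists (fun x => cint 0 1 (fun t => partial i f (set_coord i (RtoC t * proj i x) x))). split.
  - apply (holomorphic_cint (fun t x => partial i f (set_coord i (RtoC t * proj i x) x))); [lra| |].
    + apply (contC_continuous_comp (Y := C3_US) (partial i f)
      (fun q => set_coord i (RtoC (fst q) * proj i (snd q)) (snd q)) (holomorphic_cont _ Hp)).
      intros q. apply continuous_set_coord; [|apply continuous_snd'].
      revert q. apply contC_mult.
      * apply (contC_continuous_comp (Y := R_UniformSpace)
        RtoC fst contC_RtoC). intros q. apply continuous_fst'.
      * apply (contC_continuous_comp (Y := C3_US) (proj i)
        snd (continuous_proj i)). intros q. apply continuous_snd'.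
    + intros t. apply (holomorphic_set_coord (partial i f) i (fun x => RtoC t * proj i x) Hp).
      apply holomorphic_mult; [apply holomorphic_const | apply holomorphic_proj].
  - intros x.
    pose proof (holomorphic_separately f Hf i x) as He.
    pose proof (increment_line (fun t => f (set_coord i t x)) 0 (proj i x)
      He (entire_contC_derive _ He)) as H.
    simpl in H. rewrite Cplus_0_l, set_coord_proj in H. rewrite H. f_equal.
    apply cint_ext. intros t. rewrite partial_set_coord. f_equal. ring.
Qed.
(** * Behaviour at infinity *)

Lemma eq_at_0_of_eq_off_0 (f g : C -> C) :
  contC (X := C_UniformSpace) f -> contC (X := C_UniformSpace) g ->
  (forall t : C, t <> 0 -> f t = g t) -> f 0 = g 0.
Proof.
  intros Hf Hg H. apply Ceq_minus. apply (Cmod_le_eps_0 _ 1); [lra|]. intros eps.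
  destruct (proj1 (continuous_C_eps (X := C_UniformSpace) _ _)
    (contC_minus (X := C_UniformSpace) f g Hf Hg (RtoC 0)) eps) as [d Hd].
  pose proof (cond_pos d).
  assert (Hn : RtoC (d / 2) <> 0) by (intros E; apply RtoC_inj in E; lra).
  assert (Hb : ball (RtoC 0 : C_UniformSpace) d (RtoC (d / 2))).
  { apply (C_NormedModule_mixin_compat1 0 (RtoC (d / 2)) d).
    change (Cmod (RtoC (d / 2) - 0) < d)%R.
    replace (RtoC (d / 2) - 0) with (RtoC (d / 2)) by ring.
    rewrite Cmod_R, Rabs_pos_eq; lra. }
  specialize (Hd _ Hb). rewrite (H _ Hn) in Hd.
  replace (g (RtoC (d / 2)) - g (RtoC (d / 2)) - (f 0 - g 0)) with (- (f 0 - g 0)) in Hd by ring.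
  rewrite Cmod_opp in Hd. lra.
Qed.

(** [circle_derive] for the function [(z - w) g(z)], whose derivative at [w] is
    [g w]. *)
Lemma mean_value g w s : entire g ->
  cint 0 (2 * PI) (fun t => g (w + cexp (s, t))) = (2 * PI)%R * g w.
Proof.
  intros Hg.
  assert (He : entire (fun z => (1 * z + - w) * g z)) by (apply entire_mult;
    [apply entire_affine | exact Hg]).
  pose proof (circle_derive _ w s He) as H.
  replace (C_derive (fun z => (1 * z + - w) * g z) w) with (g w) in H.
  - rewrite <- H. apply cint_ext. intros t. rewrite cexp_opp. field. apply cexp_neq_0.
  - symmetry. destruct (Hg w) as [l Hl]. apply is_C_derive_unique.
    replace (g w) with (1 * g w + (1 * w + - w) * l) by ring.
    apply (is_Cderive_mult (fun z => 1 * z + - w) g); [apply is_derive_C_affine | exact Hl].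
Qed.

(** The value at [w] is the mean of [g] over circles around [w] of arbitrarily
    large radius. *)
Lemma entire_vanishing_at_infinity (g h : C -> C) : entire g ->
  contC (X := C_UniformSpace) h -> h 0 = 0 -> (forall z : C, z <> 0 -> g z = h (/ z)) ->
  forall w, g w = 0.
Proof.
  intros Hg Hh H0 Hgh w. pose proof PI_RGT_0.
  replace (g w) with (RtoC (/ (2 * PI)) * ((2 * PI)%R * g w)).
  2:{ rewrite Cmult_assoc, <- RtoC_mult, Rinv_l by lra. ring. }
  replace ((2 * PI)%R * g w) with (RtoC 0); [ring|].
  symmetry. apply (Cmod_le_eps_0 _ (2 * PI)); [lra|]. intros eps.
  destruct (proj1 (continuous_C_eps (X := C_UniformSpace) _ _) (Hh (RtoC 0)) eps) as [d Hd].
  pose proof (cond_pos d). pose proof (Cmod_ge_0 w).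
  (* On the circle of radius [Cmod w + 2 / d] the inverse is in the ball of radius [d]. *)
  assert (Hr : (0 < 2 / d)%R) by (apply Rdiv_lt_0_compat; lra).
  rewrite <- (mean_value g w (ln (Cmod w + 2 / d)) Hg).
  replace (2 * PI * eps)%R with ((2 * PI - 0) * eps)%R by ring.
  apply cint_bound; [|lra|].
  - apply (contC_vline (fun z => g (w + cexp z))). apply entire_contC.
    apply (entire_comp g (fun z => w + cexp z) Hg).
    apply entire_plus; [apply entire_const | apply entire_cexp].
  - intros t _. set (e := cexp (ln (Cmod w + 2 / d), t)).
    assert (He : Cmod e = (Cmod w + 2 / d)%R) by (unfold e; rewrite Cmod_cexp; apply exp_ln; lra).
    assert (Hwe : (2 / d <= Cmod (w + e))%R).
    { pose proof (Cmod_triangle (w + e) (- w)) as T. rewrite Cmod_opp in T.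
      replace (w + e + - w) with e in T by ring. lra. }
    assert (Hn : w + e <> 0) by (apply Cmod_gt_0; lra).
    rewrite Hgh by exact Hn.
    assert (Hb : ball (RtoC 0 : C_UniformSpace) d (/ (w + e))).
    { apply (C_NormedModule_mixin_compat1 0 (/ (w + e)) d).
      change (Cmod (/ (w + e) - 0) < d)%R.
      replace (/ (w + e) - 0) with (/ (w + e)) by ring.
      rewrite Cmod_inv by exact Hn.
      apply Rle_lt_trans with (/ (2 / d))%R; [now apply Rinv_le_contravar|].
      replace (/ (2 / d))%R with (d / 2)%R by (field; lra). lra. }
    specialize (Hd _ Hb). rewrite H0 in Hd.
    replace (h (/ (w + e)) - 0) with (h (/ (w + e))) in Hd by ring. lra.
Qed.

(** * The Schouten bracket in terms of the coefficients *)

Lemma is_Cderive_partial f i p : holomorphic f ->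
  is_Cderive (fun t => f (set_coord i t p)) (proj i p) (partial i f p).
Proof. intros Hf. apply Cderive_correct. now apply holomorphic_separately. Qed.

Lemma partial_combination f g u h v i p :
  holomorphic g -> holomorphic u -> holomorphic h -> holomorphic v ->
  (forall x, f x = g x * u x + h x * v x) ->
  partial i f p = (partial i g p * u p + g p * partial i u p)
                + (partial i h p * v p + h p * partial i v p).
Proof.
  intros Hg Hu Hh Hv E. unfold partial at 1. apply is_C_derive_unique.
  apply (is_Cderive_ext (fun t => g (set_coord i t p) * u (set_coord i t p)
    + h (set_coord i t p) * v (set_coord i t p))); [intros t; symmetry; apply E|].
  pose proof (is_Cderive_mult _ _ _ _ _ (is_Cderive_partial g i p Hg)
    (is_Cderive_partial u i p Hu)) as H1.
  pose proof (is_Cderive_mult _ _ _ _ _ (is_Cderive_partial h i p Hh)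
    (is_Cderive_partial v i p Hv)) as H2.
  pose proof (is_Cderive_plus _ _ _ _ _ H1 H2) as H3.
  cbv beta in H3. rewrite set_coord_proj in H3. exact H3.
Qed.

Lemma partial_const i c p : partial i (fun _ => c) p = 0.
Proof. apply is_C_derive_unique. apply is_Cderive_const. Qed.

Lemma partial_proj i j p : partial i (proj j) p = d_ i j p.
Proof.
  destruct i, j; unfold partial, d_;
  cbn [proj set_coord fst snd];
  first [exact (is_C_derive_unique _ _ _ (is_Cderive_id _))
    | exact (is_C_derive_unique _ _ _ (is_Cderive_const _ _))].
Qed.

Lemma skew_diag (q : bivector_field) i p : (forall i j p, q j i p = - q i j p) -> q i i p = 0.
Proof.
  intros H. pose proof (H i i p) as E.
  assert (E2 : q i i p + q i i p = 0) by (rewrite E at 1; ring).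
  replace (q i i p) with ((q i i p + q i i p) / 2) by field.
  rewrite E2. field.
Qed.

(** Both sides are polynomials in the coefficients and their first derivatives,
    by the Leibniz rule applied to the three independent components of [q].
    The factor 2 is due to the symmetry of the bracket in its two arguments. *)
Lemma schouten_B (q : bivector_field) (p : gen -> C3 -> C) x :
  holomorphic_bivector q -> (forall g, holomorphic (p g)) ->
  (forall i j x, q i j x = sum_gen (fun g => p g x * e_U g i j x)) ->
  schouten q q i0 i1 i2 x = 2 * B p x.
Proof.
  intros Hq Hp E.
  assert (E12 : forall x, q i1 i2 x = proj i1 x * p g3 x + proj i2 x * p g4 x).
  { intros y. rewrite E. unfold sum_gen, e_U, bv_add, bv_scal, wedge, d_. ring. }
  assert (E20 : forall x, q i2 i0 x = 1 * p g1 x + proj i0 x * p g3 x).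
  { intros y. rewrite E. unfold sum_gen, e_U, bv_add, bv_scal, wedge, d_. ring. }
  assert (E01 : forall x, q i0 i1 x = 1 * p g2 x + proj i0 x * p g4 x).
  { intros y. rewrite E. unfold sum_gen, e_U, bv_add, bv_scal, wedge, d_. ring. }
  assert (S : forall i j, q j i x = - q i j x) by (intros; apply Hq).
  assert (D : forall i, q i i x = 0) by (intros; apply skew_diag, Hq).
  pose proof holomorphic_proj. pose proof (holomorphic_const 1).
  assert (P12 : forall l, partial l (q i1 i2) x =
    d_ l i1 x * p g3 x + proj i1 x * partial l (p g3)
      x + (d_ l i2 x * p g4 x + proj i2 x * partial l (p g4) x)).
  { intros l. rewrite <- !partial_proj.
    apply partial_combination; auto. }
  assert (P20 : forall l, partial l (q i2 i0) x =
    partial l (p g1) x + (d_ l i0 x * p g3 x + proj i0 x * partial l (p g3) x)).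
  { intros l. rewrite <- !partial_proj.
    rewrite (partial_combination _ (fun _ => 1) (p g1) (proj i0) (p g3) l x) by auto.
    rewrite partial_const. ring. }
  assert (P01 : forall l, partial l (q i0 i1) x =
    partial l (p g2) x + (d_ l i0 x * p g4 x + proj i0 x * partial l (p g4) x)).
  { intros l. rewrite <- !partial_proj.
    rewrite (partial_combination _ (fun _ => 1) (p g2) (proj i0) (p g4) l x) by auto.
    rewrite partial_const. ring. }
  unfold schouten, sum_coord. rewrite !P12, !P20, !P01, !D.
  rewrite (S i2 i0), (S i0 i1), (S i1 i2), E12, E20, E01.
  unfold B, sum_gen, Q, d_. ring.
Qed.
(** * Decomposition of a global bivector field *)

Lemma bivector_glue_components (q : global_bivector) p : proj i0 p <> 0 ->
  let z := proj i0 p in let u1 := proj i1 p in let u2 := proj i2 p in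
  let a := biv_U q i1 i2 p in let b := biv_U q i2 i0 p in let c := biv_U q i0 i1 p in
  biv_V q i1 i2 (glue p) = z * z * a - z * u1 * b - z * u2 * c /\
  biv_V q i2 i0 (glue p) = - (b / z) /\ biv_V q i0 i1 (glue p) = - (c / z).
Proof.
  intros Hz. cbv zeta.
  assert (S : forall i j, biv_U q j i p = - biv_U q i j p) by (intros; apply (biv_U_holo q)).
  assert (D : forall i, biv_U q i i p = 0) by (intros; apply skew_diag, (biv_U_holo q)).
  rewrite !(biv_glue q p Hz). unfold sum_coord. rewrite !jac_glue by exact Hz. rewrite !D.
  rewrite (S i2 i0), (S i0 i1), (S i1 i2). repeat split; field; exact Hz.
Qed.

Lemma glue_set_coord i t p : i <> i0 ->
  glue (set_coord i t p) = set_coord i (proj i0 p * t) (glue p).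
Proof. intros Hi. destruct i; [now destruct Hi | reflexivity | reflexivity]. Qed.

(** The gluing multiplies [x_i] by [z], so that division by [x_i] takes one of
    the two factors [z], at first away from [x_i = 0]; continuity gives the
    rest. *)
Lemma hadamard_quotient_glue i f F h H : i <> i0 -> holomorphic h -> holomorphic H ->
  (forall p, f p - f (set_coord i 0 p) = proj i p * h p) ->
  (forall p, F p - F (set_coord i 0 p) = proj i p * H p) ->
  (forall p, proj i0 p <> 0 -> proj i0 p * proj i0 p * f p = F (glue p)) ->
  forall p, proj i0 p <> 0 -> proj i0 p * h p = H (glue p).
Proof.
  intros Hi Hh HH Ef EF EfF p Hz.
  assert (Hz' : forall t, proj i0 (set_coord i t p) = proj i0 p) by (intros t; now destruct i).
  assert (Hne : forall t : C, t <> 0 -> proj i0 p * h (set_coord i t p)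
    = H (glue (set_coord i t p))).
  { intros t Ht. set (pt := set_coord i t p).
    assert (Hpt : proj i0 pt = proj i0 p) by apply Hz'.
    pose proof (Ef pt) as E1. pose proof (EF (glue pt)) as E2.
    rewrite <- (Cmult_0_r (proj i0 pt)), <- glue_set_coord in E2 by exact Hi.
    assert (Hs : proj i0 (set_coord i 0 pt) = proj i0 p) by (unfold pt;
      rewrite set_coord_set_coord; apply Hz').
    rewrite <- (EfF pt) in E2 by (rewrite Hpt; exact Hz).
    rewrite <- (EfF (set_coord i 0 pt)) in E2 by (rewrite Hs; exact Hz).
    rewrite Hs, Hpt in E2.
    assert (Hg : proj i (glue pt) = proj i0 p * t) by (unfold pt;
      rewrite glue_set_coord by exact Hi; apply proj_set_coord).
    assert (Hpi : proj i pt = t) by apply proj_set_coord.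
    rewrite Hg in E2. rewrite Hpi in E1.
    transitivity ((proj i0 p * proj i0 p * (t * h pt)) / (proj i0 p * t)); [field; now split|].
    rewrite <- E1.
    transitivity ((proj i0 p * t * H (glue pt)) / (proj i0 p * t)); [|field; now split].
    rewrite <- E2. field. now split. }
  destruct (Ceq_dec (proj i p) 0) as [E|E].
  2:{ specialize (Hne _ E). now rewrite set_coord_proj in Hne. }
  rewrite <- (set_coord_proj i p), E, Hz'.
  apply (eq_at_0_of_eq_off_0 (fun t => proj i0 p * h (set_coord i t p))
    (fun t => H (glue (set_coord i t p)))); [| |exact Hne].
  - apply entire_contC, entire_mult; [apply entire_const | now apply holomorphic_separately].
  - apply entire_contC.
    apply (entire_ext (fun t => H (set_coord i (proj i0 p * t + 0) (glue p)))).
    { intros t. rewrite glue_set_coord by exact Hi. f_equal. f_equal. ring. }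
    apply (entire_comp (fun t => H (set_coord i t (glue p))));
      [now apply holomorphic_separately | apply entire_affine].
Qed.

(** [f] restricted to the zero section is [(1/z)^2 F(1/z, 0, 0)], which tends to 0
    at infinity. *)
Lemma vanishing_on_zero_section f F : holomorphic f -> holomorphic F ->
  (forall z : C, z <> 0 -> z * z * f (z, RtoC 0, RtoC 0) = F (/ z, RtoC 0, RtoC 0)) ->
  (forall z, f (z, RtoC 0, RtoC 0) = 0) /\ (forall z, F (z, RtoC 0, RtoC 0) = 0).
Proof.
  intros Hf HF E.
  pose proof (holomorphic_separately f Hf i0 (RtoC 0, RtoC 0, RtoC 0)) as ef. cbn in ef.
  pose proof (holomorphic_separately F HF i0 (RtoC 0, RtoC 0, RtoC 0)) as eF. cbn in eF.
  assert (Hf0 : forall z, f (z, RtoC 0, RtoC 0) = 0).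
  { apply (entire_vanishing_at_infinity (fun z => f (z, RtoC 0,
    RtoC 0)) (fun z => z * z * F (z, RtoC 0, RtoC 0))); [exact ef | | ring |].
    - apply entire_contC, entire_mult; [|exact eF]. apply entire_mult; apply entire_id.
    - intros z Hz. rewrite <- E by exact Hz. field. exact Hz. }
  split; [exact Hf0|].
  assert (HF0 : forall z : C, z <> 0 -> F (z, RtoC 0, RtoC 0) = 0).
  { intros z Hz. assert (Hz' : / z <> 0).
    { intros Hc. apply C1_nz. rewrite <- (Cinv_r z Hz), Hc. ring. }
    pose proof (E (/ z) Hz') as H. rewrite Hf0 in H.
    replace (/ / z) with z in H by (field; exact Hz).
    rewrite <- H. ring. }
  intros z. destruct (Ceq_dec z 0) as [->|Hz]; [|now apply HF0].
  apply (eq_at_0_of_eq_off_0 (fun z => F (z, RtoC 0, RtoC 0)) (fun _ => 0)); [| |exact HF0].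
  - now apply entire_contC.
  - apply entire_contC, entire_const.
Qed.

Ltac holo :=
  lazymatch goal with
  | |- holomorphic (fun p => @?f p + @?g p) => apply (holomorphic_plus f g); holo
  | |- holomorphic (fun p => @?f p - @?g p) => apply (holomorphic_minus f g); holo
  | |- holomorphic (fun p => @?f p * @?g p) => apply (holomorphic_mult f g); holo
  | |- holomorphic (fun p => - @?f p) => apply (holomorphic_opp f); holo
  | |- holomorphic (fun p => proj ?i p) => exact (holomorphic_proj i)
  | H : holomorphic ?f |- holomorphic (fun p => ?f p) => exact H
  end.

Lemma generators_span (q : global_bivector) :
  exists p : gen -> global_function, is_combination q p.
Proof.
  set (a := biv_U q i1 i2). set (b := biv_U q i2 i0). set (c := biv_U q i0 i1).
  set (A := biv_V q i1 i2). set (Bv := biv_V q i2 i0). set (Cv := biv_V q i0 i1).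
  destruct (biv_U_holo q) as [SU HU]. destruct (biv_V_holo q) as [SV HV].
  assert (ha : holomorphic a) by apply HU. assert (hb : holomorphic b) by apply HU.
  assert (hc : holomorphic c) by apply HU. assert (hA : holomorphic A) by apply HV.
  assert (hB : holomorphic Bv) by apply HV. assert (hC : holomorphic Cv) by apply HV.
  assert (G : forall p, proj i0 p <> 0 ->
    A (glue p) = proj i0 p * proj i0 p * a p - proj i0 p * proj i1 p * b p - proj i0 p * proj
      i2 p * c p
    /\ Bv (glue p) = - (b p / proj i0 p) /\ Cv (glue p) = - (c p / proj i0 p))
    by apply (bivector_glue_components q).
  destruct (vanishing_on_zero_section a A ha hA) as [a0 A0].
  { intros z Hz. destruct (G (z, RtoC 0, RtoC 0) Hz) as [E _]. unfold glue in E. simpl in E.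
    rewrite Cmult_0_r in E. rewrite E. ring. }
  (* The highest powers of [z] in [b] and [c] leave no choice for those of [p3]
     and [p4], namely [t3] and [t4]; without them, [a] becomes [a']. *)
  destruct (hadamard i0 Bv hB) as (dB & hdB & EB).
  destruct (hadamard i0 Cv hC) as (dC & hdC & EC).
  set (A' := fun p => A p - proj i1 p * dB p - proj i2 p * dC p).
  assert (hA' : holomorphic A') by (unfold A'; holo).
  set (t3 := fun p => - Bv (RtoC 0, proj i0 p * proj i1 p, proj i0 p * proj i2 p)).
  set (t4 := fun p => - Cv (RtoC 0, proj i0 p * proj i1 p, proj i0 p * proj i2 p)).
  assert (ht : forall f, holomorphic f -> holomorphic (fun p => - f (RtoC 0,
    proj i0 p * proj i1 p, proj i0 p * proj i2 p))).
  { intros f Hf. apply holomorphic_opp. apply (holomorphic_comp f (fun _ => 0));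
    [exact Hf | apply holomorphic_const | holo | holo]. }
  assert (ht3 : holomorphic t3) by now apply ht.
  assert (ht4 : holomorphic t4) by now apply ht.
  set (a' := fun p => a p - proj i1 p * t3 p - proj i2 p * t4 p).
  assert (ha' : holomorphic a') by (unfold a'; holo).
  assert (Ga : forall p, proj i0 p <> 0 -> proj i0 p * proj i0 p * a' p = A' (glue p)).
  { intros p Hz. destruct (G p Hz) as (E1 & E2 & E3).
    pose proof (EB (glue p)) as E4. pose proof (EC (glue p)) as E5.
    rewrite E2 in E4. rewrite E3 in E5.
    change (- (b p / proj i0 p) - Bv (RtoC 0, proj i0 p * proj i1 p,
      proj i0 p * proj i2 p) = / proj i0 p * dB (glue p)) in E4.
    change (- (c p / proj i0 p) - Cv (RtoC 0, proj i0 p * proj i1 p,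
      proj i0 p * proj i2 p) = / proj i0 p * dC (glue p)) in E5.
    assert (E6 : dB (glue p) = proj i0 p * (/ proj i0 p * dB (glue p))) by (field; exact Hz).
    assert (E7 : dC (glue p) = proj i0 p * (/ proj i0 p * dC (glue p))) by (field; exact Hz).
    rewrite <- E4 in E6. rewrite <- E5 in E7.
    unfold A', a', t3, t4. rewrite E1, E6, E7. unfold glue; simpl proj. field. exact Hz. }
  (* [a' = u1 k1 + a''] and [a'' = u2 k2], and likewise [A' = v1 K1 + v2 K2] on V. *)
  destruct (hadamard i1 a' ha') as (k1 & hk1 & Ek1).
  destruct (hadamard i1 A' hA') as (K1 & hK1 & EK1).
  pose proof (hadamard_quotient_glue i1 a' A' k1 K1 ltac:(discriminate) hk1 hK1 Ek1 EK1 Ga) as G1.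
  set (a'' := fun p => a' (set_coord i1 0 p)). set (A'' := fun p => A' (set_coord i1 0 p)).
  assert (ha'' : holomorphic a'') by (apply (holomorphic_set_coord a' i1 (fun _ => 0));
    [exact ha' | apply holomorphic_const]).
  assert (hA'' : holomorphic A'') by (apply (holomorphic_set_coord A' i1 (fun _ => 0));
    [exact hA' | apply holomorphic_const]).
  assert (Ga'' : forall p, proj i0 p <> 0 -> proj i0 p * proj i0 p * a'' p = A'' (glue p)).
  { intros p Hz. unfold a'', A''. rewrite <- (Cmult_0_r (proj i0 p)) at 2.
    rewrite <- glue_set_coord by discriminate. now apply (Ga (set_coord i1 0 p)). }
  destruct (hadamard i2 a'' ha'') as (k2 & hk2 & Ek2).
  destruct (hadamard i2 A'' hA'') as (K2 & hK2 & EK2).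
  pose proof (hadamard_quotient_glue i2 a'' A'' k2 K2 ltac:(discriminate) hk2 hK2 Ek2 EK2 Ga'')
    as G2.
  assert (a''0 : forall p, a'' (set_coord i2 0 p) = 0).
  { intros p. unfold a'', a'. simpl. rewrite a0. ring. }
  assert (A''0 : forall p, A'' (set_coord i2 0 p) = 0).
  { intros p. unfold A'', A'. simpl. rewrite A0. ring. }
  (* [p1] and [p2] on V are read off [b = p1 + z p3] and [c = p2 + z p4], where
     [z k1] and [z k2] become [K1] and [K2] by [G1] and [G2]. *)
  set (p3U := fun p => t3 p + k1 p).
  set (p4U := fun p => t4 p + k2 p).
  set (p3V := fun p => - Bv (set_coord i0 0 p) + proj i0 p * K1 p).
  set (p4V := fun p => - Cv (set_coord i0 0 p) + proj i0 p * K2 p).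
  set (p1U := fun p => b p - proj i0 p * p3U p).
  set (p2U := fun p => c p - proj i0 p * p4U p).
  set (p1V := fun p => - dB p - K1 p).
  set (p2V := fun p => - dC p - K2 p).
  assert (hs : forall f, holomorphic f -> holomorphic (fun p => f (set_coord i0 0 p))).
  { intros f Hf. apply (holomorphic_set_coord f i0 (fun _ => 0));
    [exact Hf | apply holomorphic_const]. }
  assert (h3U : holomorphic p3U) by (unfold p3U; holo).
  assert (h4U : holomorphic p4U) by (unfold p4U; holo).
  assert (h3V : holomorphic p3V) by (unfold p3V; apply holomorphic_plus;
    [apply holomorphic_opp; now apply hs | holo]).
  assert (h4V : holomorphic p4V) by (unfold p4V; apply holomorphic_plus;
    [apply holomorphic_opp; now apply hs | holo]).
  assert (h1U : holomorphic p1U) by (unfold p1U; holo).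
  assert (h2U : holomorphic p2U) by (unfold p2U; holo).
  assert (h1V : holomorphic p1V) by (unfold p1V; holo).
  assert (h2V : holomorphic p2V) by (unfold p2V; holo).
  assert (g3 : forall p, proj i0 p <> 0 -> p3V (glue p) = p3U p).
  { intros p Hz. unfold p3V, p3U. rewrite <- (G1 p Hz).
    change (t3 p + / proj i0 p * (proj i0 p * k1 p) = t3 p + k1 p). field. exact Hz. }
  assert (g4 : forall p, proj i0 p <> 0 -> p4V (glue p) = p4U p).
  { intros p Hz. unfold p4V, p4U. rewrite <- (G2 p Hz).
    change (t4 p + / proj i0 p * (proj i0 p * k2 p) = t4 p + k2 p). field. exact Hz. }
  assert (g1 : forall p, proj i0 p <> 0 -> p1V (glue p) = p1U p).
  { intros p Hz. unfold p1V, p1U, p3U. rewrite <- (G1 p Hz).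
    destruct (G p Hz) as (_ & E2 & _). pose proof (EB (glue p)) as E4. rewrite E2 in E4.
    change (- (b p / proj i0 p) - Bv (RtoC 0, proj i0 p * proj i1 p,
      proj i0 p * proj i2 p) = / proj i0 p * dB (glue p)) in E4.
    replace (dB (glue p)) with (proj i0 p * (/ proj i0 p * dB (glue p))) by (field; exact Hz).
    rewrite <- E4. unfold t3, t4. field. exact Hz. }
  assert (g2 : forall p, proj i0 p <> 0 -> p2V (glue p) = p2U p).
  { intros p Hz. unfold p2V, p2U, p4U. rewrite <- (G2 p Hz).
    destruct (G p Hz) as (_ & _ & E3). pose proof (EC (glue p)) as E4. rewrite E3 in E4.
    change (- (c p / proj i0 p) - Cv (RtoC 0, proj i0 p * proj i1 p,
      proj i0 p * proj i2 p) = / proj i0 p * dC (glue p)) in E4.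
    replace (dC (glue p)) with (proj i0 p * (/ proj i0 p * dC (glue p))) by (field; exact Hz).
    rewrite <- E4. unfold t3, t4. field. exact Hz. }
  assert (Ua : forall p, a p = proj i1 p * p3U p + proj i2 p * p4U p).
  { intros p. unfold p3U, p4U.
    transitivity (proj i1 p * t3 p + proj i2 p * t4 p + (proj i1 p * k1 p + proj i2 p * k2 p));
      [|ring].
    rewrite <- Ek1, <- Ek2, a''0. unfold a''. unfold a' at 1. ring. }
  assert (Va : forall p, A p = - (proj i1 p * p1V p + proj i2 p * p2V p)).
  { intros p. unfold p1V, p2V.
    transitivity (proj i1 p * dB p + proj i2 p * dC p + (proj i1 p * K1 p + proj i2 p * K2 p));
      [|ring].
    rewrite <- EK1, <- EK2, A''0. unfold A''. unfold A' at 1. ring. }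
  assert (Vb : forall p, Bv p = - (proj i0 p * p1V p + p3V p)).
  { intros p. unfold p1V, p3V.
    transitivity (proj i0 p * dB p + Bv (set_coord i0 0 p)); [|ring]. rewrite <- EB. ring. }
  assert (Vc : forall p, Cv p = - (proj i0 p * p2V p + p4V p)).
  { intros p. unfold p2V, p4V.
    transitivity (proj i0 p * dC p + Cv (set_coord i0 0 p)); [|ring]. rewrite <- EC. ring. }
  exists (fun g => match g with
    | g1 => Build_global_function p1U p1V h1U h1V g1
    | g2 => Build_global_function p2U p2V h2U h2V g2
    | g3 => Build_global_function p3U p3V h3U h3V g3
    | g4 => Build_global_function p4U p4V h4U h4V g4
    end).
  split.
  - assert (DU : forall i x, biv_U q i i x = 0) by (intros; now apply skew_diag).
    assert (Ub : forall p, b p = p1U p + proj i0 p * p3U p) by (intros p; unfold p1U; ring).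
    assert (Uc : forall p, c p = p2U p + proj i0 p * p4U p) by (intros p; unfold p2U; ring).
    intros i j x. unfold sum_gen. cbn [fun_U biv_U e_].
    destruct i, j; rewrite ?DU; [| fold c | rewrite SU; fold b | rewrite SU;
      fold c | | fold a | fold b | rewrite SU; fold a | ];
    rewrite ?Ua, ?Ub, ?Uc; unfold e_U, bv_add, bv_scal, wedge, d_; ring.
  - assert (DV : forall i x, biv_V q i i x = 0) by (intros; now apply skew_diag).
    intros i j x. unfold sum_gen. cbn [fun_V biv_V e_].
    destruct i, j; rewrite ?DV; [| fold Cv | rewrite SV; fold Bv | rewrite SV;
      fold Cv | | fold A | fold Bv | rewrite SV; fold A | ];
    rewrite ?Va, ?Vb, ?Vc; unfold e_V, bv_opp, bv_add, bv_scal, wedge, d_; ring.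
Qed.

Theorem theorem3p2 :
  forall q : global_bivector,
    poisson q ->
    exists p : gen -> global_function,
      is_combination q p /\ ker_B p.
Proof.
  intros q [HqU _]. destruct (generators_span q) as [p Hp]. exists p. split; [exact Hp|].
  intros x.
  pose proof (schouten_B (biv_U q) (fun g => fun_U (p g)) x (biv_U_holo q)
    (fun g => fun_U_holo (p g)) (proj1 Hp)) as E.
  rewrite HqU in E.
  replace (B (fun g => fun_U (p g)) x) with ((2 * B (fun g => fun_U (p g)) x) / 2) by field.
  rewrite <- E. field.
Qed.
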